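(* Let $\lambda>0$, $\beta>0$, and consider the random-connection model on a Poisson point process on $\mathbb{R}^d$ with flat intensity $\lambda\,dx$ and Rayleigh fading connection function $H_\beta(a,b)=e^{-\beta\|a-b\|^2}$, $a,b\in\mathbb{R}^d$. The variance of the $3$-hop count between $x\in\mathbb{R}^d$ and $y\in\mathbb{R}^d$, $x\neq y$, is given by $$ \mathrm{Var}\left[N^{x,y}_3\right]=2\lambda^3\left(\frac{\pi^3}{8\beta^3}\right)^{d/2}e^{-\beta\|x-y\|^2/2}+\lambda^2\left(\frac{\pi^2}{3\beta^2}\right)^{d/2}e^{-\beta\|x-y\|^2/3}+2\lambda^3\left(\frac{\pi^3}{12\beta^3}\right)^{d/2}e^{-3\beta\|x-y\|^2/4}+\lambda^2\left(\frac{\pi^2}{8\beta^2}\right)^{d/2}e^{-\beta\|x-y\|^2}. $$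
   Context: Let $\omega$ be the Poisson point process. Random-connection model: the vertex set is $\omega\cup\{x,y\}$; given $\omega$, each unordered pair of distinct vertices $\{a,b\}$ is joined by an edge (written $a\leftrightarrow b$) with probability $H_\beta(a,b)$, independently over distinct pairs. The $3$-hop count $N^{x,y}_3$ is the number of ordered pairs $(z_1,z_2)$ of distinct points of $\omega$ such that $x\leftrightarrow z_1$, $z_1\leftrightarrow z_2$ and $z_2\leftrightarrow y$. *)

(* Defs.v *)
From HB Require Import structures.
From mathcomp Require Import all_boot all_order all_algebra finmap.
From mathcomp Require Import all_classical all_reals all_analysis.

Set Implicit Arguments.
Unset Strict Implicit.
Unset Printing Implicit Defensive.

Import Order.TTheory GRing.Theory Num.Theory.
Local Open Scope classical_set_scope.
Local Open Scope ring_scope.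

(* Points of R^d are d.-tuple R, whose product sigma-algebra is the Borel
   sigma-algebra of R^d. *)

Section connection_function.
Context {R : realType} {d : nat}.
Implicit Types a b : d.-tuple R.

(* The library norm on vectors is the sup norm, not the Euclidean one. *)
Definition eucl_dist a b : R :=
  Num.sqrt (\sum_(i < d) (tnth a i - tnth b i) ^+ 2).

Definition rayleigh (beta : R) a b : R := expR (- (beta * eucl_dist a b ^+ 2)).

End connection_function.

Section lebesgue_cons.
Context {R : realType} {n : nat}.
Variable mu : {sigma_finite_measure set (n.-tuple R) -> \bar R}.

Definition cons_pair (p : measurableTypeR R * n.-tuple R) : n.+1.-tuple R :=
  [tuple of (p.1 : R) :: p.2].

Lemma measurable_cons_pair : measurable_fun setT cons_pair.
Proof.
apply: measurable_cons; last exact: measurable_snd.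
exact: (@measurable_fst _ _ (measurableTypeR R) (n.-tuple R)).
Qed.

Definition lebesgue_cons : set (n.+1.-tuple R) -> \bar R :=
  pushforward (lebesgue_measure \x mu)%E cons_pair.

Let lebesgue_cons0 : lebesgue_cons set0 = 0%E.
Proof. by rewrite /lebesgue_cons /pushforward preimage_set0 measure0. Qed.

Let lebesgue_cons_ge0 A : (0 <= lebesgue_cons A)%E.
Proof. by rewrite /lebesgue_cons /pushforward; exact: measure_ge0. Qed.

Let lebesgue_cons_sigma_additive : semi_sigma_additive lebesgue_cons.
Proof.
exact: (@measure_semi_sigma_additive _ _ _
  (@measure_function_pushforward__canonical__measure_function_Measure
    _ _ _ _ _ (lebesgue_measure \x mu)%E _ measurable_cons_pair)).
Qed.

HB.instance Definition _ := isMeasure.Build _ _ _ lebesgue_cons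
  lebesgue_cons0 lebesgue_cons_ge0 lebesgue_cons_sigma_additive.

Let lebesgue_cons_sigma_finite : sigma_finite setT lebesgue_cons.
Proof.
have /sigma_finiteP[F [FT Fnd Foo]] := sigma_finiteT (@lebesgue_measure R).
have /sigma_finiteP[G [GT Gnd Goo]] := sigma_finiteT mu.
pose uncons (t : n.+1.-tuple R) : measurableTypeR R * n.-tuple R :=
  (thead t, [tuple of behead t]).
have uncons_cons t : cons_pair (uncons t) = t.
  by rewrite [RHS]tuple_eta; exact/val_inj.
have cons_uncons p : uncons (cons_pair p) = p.
  by case: p => a t; congr pair; exact/val_inj.
have muncons : measurable_fun setT uncons.
  apply: (@measurable_fun_pair _ _ _ _ (measurableTypeR R)).
    exact: (@measurable_tnth _ R n.+1 ord0).
  exact: measurable_behead.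
exists (fun k => uncons @^-1` (F k `*` G k)).
  rewrite predeqE => t; split => // _.
  have [i _ Fi] : (\bigcup_i F i) (uncons t).1 by rewrite -FT.
  have [j _ Gj] : (\bigcup_i G i) (uncons t).2 by rewrite -GT.
  exists (maxn i j) => //; split.
    by move: (_.1) Fi; exact/subsetPset/Fnd/leq_maxl.
  by move: (_.2) Gj; exact/subsetPset/Gnd/leq_maxr.
move=> k; have [mF Fk] := Foo k; have [mG Gk] := Goo k; split.
  by rewrite -[X in measurable X]setTI; apply: muncons => //; exact: measurableX.
rewrite /lebesgue_cons /pushforward -comp_preimage.
rewrite (_ : uncons \o cons_pair = id); last exact/funext.
by rewrite preimage_id product_measure1E// lte_mul_pinfty// ge0_fin_numE.
Qed.

HB.instance Definition _ := Measure_isSigmaFinite.Build _ _ _ lebesgue_cons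
  lebesgue_cons_sigma_finite.

End lebesgue_cons.

(* d-dimensional Lebesgue measure; see lebesgue_tupleE for its value on boxes. *)
Fixpoint lebesgue_tuple (R : realType) (d : nat) :
    {sigma_finite_measure set (d.-tuple R) -> \bar R} :=
  match d with
  | 0 => \d_([tuple] : 0.-tuple R)
  | d'.+1 => lebesgue_cons (lebesgue_tuple R d')
  end.


Lemma lebesgue_tupleE (R : realType) (d : nat) (A : 'I_d -> set R) :
  (forall i, measurable (A i)) ->
  lebesgue_tuple R d [set t | forall i, A i (tnth t i)] =
  (\prod_(i < d) lebesgue_measure (A i))%E.
Proof.
elim: d A => [|d IH] A mA.
  by rewrite big_ord0 /= diracE mem_set// => -[].
have mbox : measurable [set t : d.-tuple R | forall i, A (lift ord0 i) (tnth t i)].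
  rewrite (_ : [set _ | _] = \bigcap_(i : 'I_d)
      ((fun t => tnth t i) @^-1` A (lift ord0 i))).
    apply: fin_bigcap_measurable => // i _.
    by rewrite -[X in measurable X]setTI; exact: measurable_tnth.
  by apply/seteqP; split => t /= h i *; exact: h.
rewrite big_ord_recl -IH//= /lebesgue_cons /pushforward -product_measure1E//.
congr product_measure1; apply/seteqP; split => -[a t] /=.
  move=> h; split => [|i]; first exact: h ord0.
  by have := h (lift ord0 i); rewrite tnthS.
by move=> [Aa h] i; case: (unliftP ord0 i) => [j ->|->]//; rewrite tnthS.
exact: mA.
Qed.

Section random_connection_model.
Context {R : realType} {d : nat} {disp : measure_display}.
Context {Omega : measurableType disp} (P : probability Omega R).
Implicit Types (omega : Omega -> set (d.-tuple R)) (x y : d.-tuple R).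
Implicit Types (edge : Omega -> d.-tuple R -> d.-tuple R -> Prop).

Definition count_event omega (B : set (d.-tuple R)) (k : nat) : set Omega :=
  [set w | (omega w `&` B #= `I_k)%card].

(* The second argument of poisson_prob is a dummy; unlike poisson_pmf,
   poisson_prob is the Dirac mass at 0 for the parameter 0. *)
Record poisson_process (Lambda : set (d.-tuple R) -> \bar R) omega : Prop := {
  pp_locally_finite : forall w a (r : R),
    finite_set (omega w `&` [set b | eucl_dist a b <= r]) ;
  pp_measurable : forall B k, measurable B ->
    measurable (count_event omega B k) ;
  pp_poisson : forall B k, measurable B -> (Lambda B < +oo)%E ->
    P (count_event omega B k) = poisson_prob (fine (Lambda B)) 0 [set k] ;
  pp_independent : forall n (B : 'I_n -> set (d.-tuple R)) (k : 'I_n -> nat),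
    (forall i, measurable (B i)) -> trivIset setT B ->
    P (\bigcap_i count_event omega (B i) (k i)) =
    (\prod_(i < n) P (count_event omega (B i) (k i)))%E
}.

(* A measurable enumeration of the vertices: v 0 = x, v 1 = y, and the points
   of omega are the v i with i >= 2, listed without repetition. As omega may be
   finite on some outcomes, v i is meaningful on the event D i only. *)
Record vertex_enum omega x y (D : nat -> set Omega)
    (v : nat -> Omega -> d.-tuple R) : Prop := {
  ve_measurableD : forall i, measurable (D i) ;
  ve_measurable : forall i, measurable_fun (D i) (v i) ;
  ve_x : D 0%N = setT /\ forall w, v 0%N w = x ;
  ve_y : D 1%N = setT /\ forall w, v 1%N w = y ;
  ve_points : forall w,
    omega w = [set a | exists i, [/\ (2 <= i)%N, D i w & v i w = a]] ;
  ve_inj : forall w i j, (2 <= i)%N -> (2 <= j)%N -> D i w -> D j w ->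
    v i w = v j w -> i = j
}.

Definition vertex_sigma (D : nat -> set Omega)
    (v : nat -> Omega -> d.-tuple R) : set (set Omega) :=
  <<s [set A | exists i B, measurable B /\ A = D i `&` v i @^-1` B] >>.

(* An unordered pair of distinct vertices is a pair of indices e.1 < e.2.
   The last clause says that, conditionally on the vertices, the edges are independent
   and e is present with probability H (v e.1) (v e.2): the conditional
   probability that all the edges of a finite family F are present is the
   product of these probabilities. *)
Definition random_connection_model (H : d.-tuple R -> d.-tuple R -> R)
    omega x y edge : Prop :=
  [/\ forall w a, ~ edge w a a,
      forall w a b, edge w a b -> edge w b a &
      exists D v, [/\ vertex_enum omega x y D v,
        forall i j, (i < j)%N ->
          measurable [set w | [/\ D i w, D j w & edge w (v i w) (v j w)]] &
        forall (F : {fset nat * nat}) (A : set Omega),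
          (forall e, e \in F -> (e.1 < e.2)%N) ->
          vertex_sigma D v A ->
          (forall e, e \in F -> A `<=` D e.1 `&` D e.2) ->
          P (A `&` [set w | forall e, e \in F ->
                              edge w (v e.1 w) (v e.2 w)]) =
          (\int[P]_(w in A) (\prod_(e <- F) H (v e.1 w) (v e.2 w))%:E)%E]].

Definition hops3 omega x y edge (w : Omega) : set (d.-tuple R * d.-tuple R) :=
  [set z | [/\ omega w z.1, omega w z.2 & z.1 <> z.2] /\
           [/\ edge w x z.1, edge w z.1 z.2 & edge w z.2 y]].

(* An infinite count, an event of probability zero in the Poisson case, is
   sent to 0 by fine. *)
Definition hop3_count omega x y edge (w : Omega) : R :=
  fine (counting (hops3 omega x y edge w)).

End random_connection_model.

(* Main.v *)
From HB Require Import structures.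
Require Import Defs.
From mathcomp Require Import finmap.
From mathcomp Require Import all_boot all_order all_algebra.
From mathcomp Require Import all_classical all_reals all_analysis.
From mathcomp Require Import measurable_realfun ring lra zify.

Set Implicit Arguments.
Unset Strict Implicit.
Unset Printing Implicit Defensive.

Import Order.TTheory GRing.Theory Num.Theory.
Local Open Scope classical_set_scope.
Local Open Scope ring_scope.

(** The count [N] is the sum, over the ordered pairs [t] of distinct points of the
    process, of the indicator that [t] is the pair of inner vertices of a path from
    [x] to [y] with three edges. So the second moment of [N] is a sum, over two such
    pairs, of the probability that both paths are present, and the union of the two
    paths is a copy of one of finitely many graphs, according to the inner vertices
    that they share ([pair_prob_split]): none, one (which can be the first vertex on
    both paths, the last on both, or the first on one and the last on the other, in two
    ways), or both (in the same or in the opposite order).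

    The expected number of copies of a graph with [k] free vertices is [lambda ^ k]
    times the integral, over the positions of these vertices, of the product of the
    connection probabilities of its edges ([expected_copies]): given the points, the
    edges are independent, and the sum over sequences of [k] distinct points of the
    process has expectation [lambda ^ k] times a Lebesgue integral. The latter
    statement says that the factorial moment measures of the process are the powers
    of its intensity ([moment_measure_lebesgue]). On a product of pairwise disjoint
    regions it is just the product rule for independent counts with known means, which
    are the means of Poisson laws ([poisson_mean]). Such products inside a fixed product
    of distinct cells of a grid form a pi-system, and the products of distinct cells
    cover all sequences of distinct points; the remaining diagonals have measure zero.

    For the Rayleigh connection function all these integrals are Gaussian. They are
    computed one vertex at a time by completing the square ([rayleighM],
    [integral_rayleighM]). Two paths without a common inner vertex give exactly the
    square of the expectation of [N], which the variance subtracts. The paths that share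
    one vertex give the two terms in [lambda ^ 3], each one twice, and the paths that
    share both vertices the two terms in [lambda ^ 2]. *)

(** * Sums of nonnegative extended reals over countable sets *)

Section esum_countable.
Context {R : realType} {T : countType}.
Implicit Types (a : T -> \bar R).
Local Open Scope ereal_scope.

(** An enumeration of the index type turns the sum into a series, so that the
    convergence theorems for series of functions apply. *)
Lemma esum_pickle a : (forall t, 0 <= a t) ->
  \esum_(t in [set: T]) a t = \sum_(n <oo) oapp a 0 (pickle_inv n).
Proof.
move=> a0; pose b n := oapp a 0 (@pickle_inv T n).
have b0 n : 0 <= b n by rewrite /b; case: pickle_inv => //=.
rewrite nneseries_esumT// [RHS](esumID (range (@pickle T))); last by move=> n _; exact: b0.
rewrite !setTI.
rewrite [X in _ + X]esum1 ?adde0; last first.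
  move=> n nr; rewrite /b; have := @pickle_invK T n.
  by case: pickle_inv => [t /= tn|//]; exfalso; apply: nr; exists t.
rewrite esum_image; first by apply: eq_esum => t _; rewrite /b pickleK_inv.
by move=> s t _ _ /(pcan_inj pickleK).
Qed.

Lemma esumZl (c : \bar R) a : 0 <= c -> (forall t, 0 <= a t) ->
  \esum_(t in [set: T]) (c * a t) = c * \esum_(t in [set: T]) a t.
Proof.
move=> c0 a0; rewrite !esum_pickle//; last by move=> t; exact: mule_ge0.
have b0 n : 0 <= oapp a 0 (@pickle_inv T n) by case: pickle_inv => //=.
rewrite -[in RHS]ge0_integral_count// -ge0_integralZl// ge0_integral_count//.
  by apply: eq_eseriesr => n _; case: pickle_inv => //=; rewrite mule0.
by move=> n; exact: mule_ge0.
Qed.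

Lemma esumZr (c : \bar R) a : 0 <= c -> (forall t, 0 <= a t) ->
  \esum_(t in [set: T]) (a t * c) = (\esum_(t in [set: T]) a t) * c.
Proof.
by move=> c0 a0; rewrite [RHS]muleC -esumZl//; apply: eq_esum => t _; rewrite muleC.
Qed.

Lemma integral_esum d (X : measurableType d) (mu : {measure set X -> \bar R})
    (f : T -> X -> \bar R) :
  (forall t, measurable_fun [set: X] (f t)) -> (forall t x, 0 <= f t x) ->
  \int[mu]_x (\esum_(t in [set: T]) f t x) =
  \esum_(t in [set: T]) \int[mu]_x f t x.
Proof.
move=> mf f0; rewrite esum_pickle; last by move=> t; exact: integral_ge0.
transitivity (\int[mu]_x (\sum_(n <oo) oapp (f ^~ x) 0 (@pickle_inv T n))).
  by apply: eq_integral => x _; rewrite esum_pickle.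
rewrite (integral_nneseries _ _ (f := fun n x => oapp (f ^~ x) 0 (@pickle_inv T n)))//.
- apply: eq_eseriesr => n _; case: pickle_inv => [t|]//=.
  by rewrite integral0.
- by move=> n; case: pickle_inv => [t|]/=; [exact: mf|exact: measurable_cst].
- by move=> n x _; case: pickle_inv => [t|]/=.
Qed.

Lemma measurable_esum d (X : measurableType d) (f : T -> X -> \bar R) :
  (forall t, measurable_fun [set: X] (f t)) -> (forall t x, 0 <= f t x) ->
  measurable_fun [set: X] (fun x => \esum_(t in [set: T]) f t x).
Proof.
move=> mf f0.
rewrite (_ : (fun _ => _) =
    fun x => \sum_(n <oo) oapp (f ^~ x) 0 (@pickle_inv T n)); last first.
  by apply/funext => x; rewrite esum_pickle.
apply: ge0_emeasurable_sum => [n x _ _|n _].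
  by case: pickle_inv => [t|]/=.
by case: pickle_inv => [t|]/=; [exact: mf|exact: measurable_cst].
Qed.

End esum_countable.

Section esum_misc.
Context {R : realType}.
Local Open Scope ereal_scope.

Lemma countingE (T : choiceType) (A : set T) :
  counting A = \esum_(t in A) 1 :> \bar R.
Proof.
rewrite /counting; case: asboolP => [finA|infA].
  rewrite esum_fset// fsbig_finite// sumEFin/= big_const_seq/= count_predT.
  by rewrite -Monoid.iteropE /=.
apply/esym/eq_infty => r.
have [B BA nB] := infinite_set_fset (Num.truncn `|r|).+1 infA.
apply: esum_ge; exists [set` B]; first by split => //; exact: finite_fset.
rewrite fsbig_finite// set_fsetK sumEFin/= big_const_seq/= count_predT.
rewrite -Monoid.iteropE /= lee_fin (le_trans (ler_norm r))//.
by rewrite (le_trans (ltW (truncnS_gt _)))// ler_nat.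
Qed.

Lemma finite_esum1 (T : choiceType) (A : set T) k : finite_set A ->
  (A #= `I_k)%card <-> \esum_(t in A) 1 = k%:R%:E :> \bar R.
Proof.
move=> finA; rewrite -countingE /counting asboolT//; split.
  by move=> /card_fset_set ->.
move=> [] /eqP; rewrite eqr_nat => /eqP <-; rewrite -{1}(fset_setK finA).
exact/card_eq_fsetP.
Qed.

(** Distributivity of finite products over infinite sums. *)
Lemma esum_tuple_prod k (a : 'I_k -> nat -> \bar R) :
  (forall i n, 0 <= a i n) ->
  \esum_(t in [set: k.-tuple nat]) \prod_(i < k) a i (tnth t i) =
  \prod_(i < k) \esum_(n in [set: nat]) a i n.
Proof.
elim: k a => [|k IH] a a0.
  rewrite big_ord0 (_ : [set: _] = [set [tuple]]); last first.
    by apply/seteqP; split => // t _; rewrite [t]tuple0.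
  by rewrite esum_set1 ?big_ord0.
have aS0 i n : 0 <= a (lift ord0 i) n by [].
rewrite big_ord_recl -IH// -esumZr//; last first.
  by apply: esum_ge0 => t _; exact: prode_ge0.
transitivity (\esum_(n in [set: nat]) \esum_(t in [set: k.-tuple nat])
    (a ord0 n * \prod_(i < k) a (lift ord0 i) (tnth t i))); last first.
  apply: eq_esum => n _; rewrite (esumZl (a0 ord0 n))// => t.
  exact: prode_ge0.
rewrite esum_esum; last by move=> i j _ _; rewrite mule_ge0//; exact: prode_ge0.
rewrite (reindex_esum (setT `*`` (fun=> setT)) _
  (fun p : nat * k.-tuple nat => [tuple of p.1 :: p.2])).
  apply: eq_esum => -[n t] _ /=; rewrite big_ord_recl tnth0.
  congr *%E; apply: eq_bigr => i _; congr (a _ _).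
  by rewrite !(tnth_nth 0%N).
split => //.
- by move=> [n s] [m t] _ _ /= [-> st]; congr pair; exact/val_inj.
- move=> t _; exists (thead t, [tuple of behead t]) => //=.
  by rewrite [RHS]tuple_eta.
Qed.

Lemma prode_indic T k (A : 'I_k -> set T) t :
  \prod_(i < k) (\1_(A i) t)%:E = (\1_(\bigcap_i A i) t)%:E :> \bar R.
Proof.
have [At|/existsNP[i Ait]] := pselect (forall i, A i t).
  rewrite indicE mem_set => [|i _]; last exact: At.
  by rewrite big1// => i _; rewrite indicE mem_set.
rewrite indicE memNset => [|At]; last by apply: Ait; exact: At.
by rewrite (bigD1 i)//= indicE memNset// mul0e.
Qed.

Lemma emeasurable_prod d (X : measurableType d) k (f : 'I_k -> X -> \bar R) :
  (forall i, measurable_fun [set: X] (f i)) ->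
  measurable_fun [set: X] (fun t => \prod_(i < k) f i t).
Proof.
elim: k f => [|k IH] f mf.
  by under eq_fun do rewrite big_ord0; exact: measurable_cst.
under eq_fun do rewrite big_ord_recl.
by apply: emeasurable_funM; [exact: mf|apply: IH => i; exact: mf].
Qed.

End esum_misc.

(** * Powers of a measure *)

(** The measurability of [f] is an argument, which makes the pushforward a bundled
    measure. *)
Definition pushforward_measure d1 d2 (T1 : measurableType d1)
    (T2 : measurableType d2) (R : realType) (m : {measure set T1 -> \bar R})
    (f : T1 -> T2) (mf : measurable_fun setT f) : {measure set T2 -> \bar R} :=
  @measure_function_pushforward__canonical__measure_function_Measure
    _ _ _ _ _ m f mf.

Section tuple_cons.
Context {d} {T : measurableType d} {R : realType} {n : nat}.

Definition tcons (p : T * n.-tuple T) : n.+1.-tuple T := [tuple of p.1 :: p.2].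

Definition tuncons (t : n.+1.-tuple T) : T * n.-tuple T :=
  (thead t, [tuple of behead t]).

Lemma tconsK : cancel tcons tuncons.
Proof. by case=> a t; congr pair; exact/val_inj. Qed.

Lemma measurable_tcons : measurable_fun setT tcons.
Proof. by apply: measurable_cons; [exact: measurable_fst|exact: measurable_snd]. Qed.

Lemma measurable_tuncons : measurable_fun setT tuncons.
Proof.
by apply: measurable_fun_pair; [exact: measurable_tnth|exact: measurable_behead].
Qed.

Section measures.
Variables (mu : {sigma_finite_measure set T -> \bar R}).
Variables (nu : {sigma_finite_measure set (n.-tuple T) -> \bar R}).
Local Open Scope ereal_scope.

Lemma integral_tcons (f : n.+1.-tuple T -> \bar R) :
  measurable_fun [set: n.+1.-tuple T] f -> (forall t, 0 <= f t) ->
  \int[pushforward (mu \x nu) tcons]_t f t =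
  \int[mu]_a \int[nu]_t f [tuple of a :: t].
Proof.
move=> mf f0; rewrite (ge0_integral_pushforward measurable_tcons)//.
rewrite preimage_setT fubini_tonelli1//=.
exact: measurableT_comp mf measurable_tcons.
Qed.

Definition cons_measure : set (n.+1.-tuple T) -> \bar R :=
  pushforward (mu \x nu) tcons.

HB.instance Definition _ := Measure.copy cons_measure
  (pushforward_measure (mu \x nu)%E measurable_tcons).

Let cons_measure_sigma_finite : sigma_finite setT cons_measure.
Proof.
have /sigma_finiteP[F [FT Fnd Foo]] := sigma_finiteT mu.
have /sigma_finiteP[G [GT Gnd Goo]] := sigma_finiteT nu.
have FG : \bigcup_i (F i `*` G i) = setT.
  rewrite -subTset => -[a t] _.
  have [i _ Fi] : (\bigcup_i F i) a by rewrite -FT.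
  have [j _ Gj] : (\bigcup_i G i) t by rewrite -GT.
  exists (maxn i j) => //; split => /=.
    by move: (a) Fi; exact/subsetPset/Fnd/leq_maxl.
  by move: (t) Gj; exact/subsetPset/Gnd/leq_maxr.
exists (fun i => tuncons @^-1` (F i `*` G i)); first by rewrite -preimage_bigcup FG.
move=> i; have [mF Fi] := Foo i; have [mG Gi] := Goo i; split.
  by rewrite -[X in measurable X]setTI; apply: measurable_tuncons => //; exact: measurableX.
rewrite /cons_measure /pushforward -comp_preimage.
rewrite (_ : tuncons \o tcons = id); last by apply/funext => p; exact: tconsK.
by rewrite preimage_id product_measure1E// lte_mul_pinfty// ge0_fin_numE.
Qed.

HB.instance Definition _ := Measure_isSigmaFinite.Build _ _ _ cons_measure
  cons_measure_sigma_finite.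

End measures.
End tuple_cons.

Fixpoint power_measure d (T : measurableType d) (R : realType)
    (mu : {sigma_finite_measure set T -> \bar R}) (n : nat) :
    {sigma_finite_measure set (n.-tuple T) -> \bar R} :=
  match n with
  | 0 => \d_([tuple] : 0.-tuple T)
  | n'.+1 => cons_measure mu (power_measure mu n')
  end.

Section power_measure_theory.
Context {d} {T : measurableType d} {R : realType}.
Variable mu : {sigma_finite_measure set T -> \bar R}.
Local Open Scope ereal_scope.

Lemma integral_power_measure0 (f : 0.-tuple T -> \bar R) :
  measurable_fun [set: 0.-tuple T] f ->
  \int[power_measure mu 0]_t f t = f [tuple].
Proof. by move=> mf; rewrite /= integral_dirac// diracT mul1e. Qed.

Lemma integral_power_measureS n (f : n.+1.-tuple T -> \bar R) :
  measurable_fun [set: n.+1.-tuple T] f -> (forall t, 0 <= f t) ->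
  \int[power_measure mu n.+1]_t f t =
  \int[mu]_a \int[power_measure mu n]_t f [tuple of a :: t].
Proof. exact: integral_tcons. Qed.

Lemma measurable_rectangle n (A : 'I_n -> set T) : (forall i, measurable (A i)) ->
  measurable [set t : n.-tuple T | forall i, A i (tnth t i)].
Proof.
move=> mA; rewrite (_ : [set _ | _] =
    \bigcap_(i in [set: 'I_n]) ((fun t => tnth t i) @^-1` A i)).
  apply: fin_bigcap_measurable => // i _.
  by rewrite -[X in measurable X]setTI; exact: measurable_tnth.
by apply/seteqP; split => t /= h i *; exact: h.
Qed.

Lemma power_measure_rectangle n (A : 'I_n -> set T) :
  (forall i, measurable (A i)) ->
  power_measure mu n [set t | forall i, A i (tnth t i)] = \prod_(i < n) mu (A i).
Proof.
elim: n A => [|n IH] A mA.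
  by rewrite big_ord0 /= diracE mem_set// => -[].
have mA' i : measurable (A (lift ord0 i)) by [].
rewrite big_ord_recl -IH//= /cons_measure /pushforward -product_measure1E//.
  congr product_measure1; apply/seteqP; split => -[a t] /=.
    move=> h; split => [|i]; first exact: h ord0.
    by have := h (lift ord0 i); rewrite tnthS.
  by move=> [Aa h] i; case: (unliftP ord0 i) => [j ->|->]//; rewrite tnthS.
exact: (@measurable_rectangle _ (fun i => A (lift ord0 i))).
Qed.

End power_measure_theory.

Section diagonal.
Context {d} {T : measurableType d} {R : realType}.
Variable mu : {sigma_finite_measure set T -> \bar R}.
Hypothesis diagT : measurable [set p : T * T | p.1 = p.2].
Hypothesis mu1 : forall a, mu [set a] = 0%E.
Local Open Scope ereal_scope.

Lemma measurable_uniq n : measurable [set t : n.-tuple T | uniq t].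
Proof.
rewrite (_ : [set _ | _] = \bigcap_(i in [set: 'I_n])
    \bigcap_(j in [set j : 'I_n | (i < j)%N])
    ~` [set t | tnth t i = tnth t j]); last first.
  apply/seteqP; split => t /=.
    move=> ut i _ j /= ij /eqP; rewrite !(tnth_nth point) nth_uniq ?size_tuple//.
    by rewrite ltn_eqF.
  move=> ut; apply/(uniqPn point) => -[i [j [ij]]].
  rewrite size_tuple => jn tij; have iN := ltn_trans ij jn.
  by apply: (ut (Ordinal iN) I (Ordinal jn) ij) => /=; rewrite !(tnth_nth point).
apply: fin_bigcap_measurable => // i _; apply: fin_bigcap_measurable => // j _.
apply: measurableC.
have := @measurable_fun_pair _ _ _ (n.-tuple T) T T _ _
  (measurable_tnth i) (measurable_tnth j) measurableT _ diagT.
by rewrite setTI.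
Qed.

Lemma measurable_set1_diag (a : T) : measurable [set a].
Proof.
rewrite -[X in measurable X]setTI.
exact: (@measurable_fun_pair _ _ _ T T T id (cst a)
  (@measurable_id _ _ _) (@measurable_cst _ _ _ _ _ _) measurableT _ diagT).
Qed.

Lemma mem_consE (a : T) s : [set` a :: s] = a |` [set` s].
Proof.
apply/seteqP; split => b /=; rewrite inE; first by case/orP => [/eqP|]; [left|right].
by move=> [->|->]; rewrite ?eqxx ?orbT.
Qed.

Lemma measurable_seq (s : seq T) : measurable [set` s].
Proof.
elim: s => [|b s IH]; first by rewrite (_ : [set` _] = set0)//; apply/seteqP; split.
by rewrite mem_consE; apply: measurableU => //; exact: measurable_set1_diag.
Qed.

Lemma measure_seq0 (s : seq T) : mu [set` s] = 0.
Proof.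
elim: s => [|a s IH].
  by rewrite (_ : [set` [::]] = set0) ?measure0//; apply/seteqP; split.
apply/eqP; rewrite eq_le measure_ge0 andbT mem_consE.
have : mu (a |` [set` s]) <= mu [set a] + mu [set` s].
  apply: measureU2; [exact: measurable_set1_diag|exact: measurable_seq].
by rewrite mu1 IH add0e.
Qed.

(** The diagonals are null because the section of the diagonal at fixed distinct
    points is the finite set of these points. *)
Lemma power_measure_diagonal n :
  power_measure mu n [set t : n.-tuple T | ~~ uniq t] = 0.
Proof.
have mU k : measurable [set t : k.-tuple T | ~~ uniq t].
  rewrite (_ : [set _ | _] = ~` [set t : k.-tuple T | uniq t]).
    by apply: measurableC; exact: (@measurable_uniq k).
  by apply/seteqP; split => t /= /negP.
elim: n => [|n IH].
  rewrite (_ : [set _ | _] = set0) ?measure0//; apply/seteqP; split => // t /=.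
  by rewrite tuple0.
transitivity (\int[power_measure mu n.+1]_t
    (\1_[set t : n.+1.-tuple T | ~~ uniq t] t)%:E).
  by rewrite (integral_indic _ measurableT (mU n.+1)) setIT.
set f := fun p : T * n.-tuple T => (\1_[set t : n.+1.-tuple T | ~~ uniq t]
  [tuple of p.1 :: p.2])%:E : \bar R.
have mf : measurable_fun setT f.
  apply/measurable_EFinP; apply: measurableT_comp measurable_tcons.
  by apply: measurable_indic; exact: mU.
have f0 p : 0 <= f p by rewrite /f lee_fin.
transitivity (\int[mu]_a fubini_F (power_measure mu n) f a).
  apply: integral_power_measureS; last by move=> t; rewrite lee_fin.
  by apply/measurable_EFinP; apply: measurable_indic; exact: mU.
rewrite -fubini_tonelli1// fubini_tonelli2//.
transitivity (\int[power_measure mu n]_t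
    (mu setT * (\1_[set t : n.-tuple T | ~~ uniq t] t)%:E)).
  apply: eq_integral => t _; rewrite /fubini_G.
  have [ut|ut] := boolP (uniq t); rewrite indicE; last first.
    rewrite mem_set//= mule1 (eq_integral (cst 1)); last first.
      by move=> a _; rewrite /f indicE mem_set//= negb_and ut orbT.
    by rewrite integral_cst// mul1e.
  rewrite memNset/= ?ut// mule0.
  rewrite (eq_integral (fun a => (\1_[set` t] a)%:E)); last first.
    move=> a _; rewrite /f !indicE; congr (nat_of_bool _)%:R%:E.
    by apply/idP/idP => /set_mem h; apply/mem_set; move: h => /=; rewrite ut andbT negbK.
  rewrite (integral_indic _ measurableT (measurable_seq t)) setIT.
  exact: measure_seq0.
rewrite ge0_integralZl//; last by apply/measurable_EFinP; apply: measurable_indic; exact: mU.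
rewrite (integral_indic _ measurableT (mU n)) setIT.
by rewrite [X in _ * X]IH mule0.
Qed.

End diagonal.

Section rectangles.
Context {d} {T : measurableType d} {R : realType} {n : nat}.

Definition rectangles : set (set (n.-tuple T)) :=
  [set X | exists A : 'I_n -> set T, (forall i, measurable (A i)) /\
           X = [set t | forall i, A i (tnth t i)]].

Lemma setI_rectangles : setI_closed rectangles.
Proof.
move=> _ _ [A [mA ->]] [B [mB ->]]; exists (fun i => A i `&` B i); split.
  by move=> i; exact: measurableI.
apply/seteqP; split => t /=; first by move=> [tA tB] i; split; [exact: tA|exact: tB].
by move=> tAB; split => i; have [] := tAB i.
Qed.

Lemma measurable_tupleE : @measurable _ (n.-tuple T) = <<s rectangles >>.
Proof.
apply/seteqP; split; last first.
  apply: smallest_sub; first exact: sigma_algebra_measurable.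
  by move=> _ [A [mA ->]]; exact: measurable_rectangle.
apply: smallest_sub; first exact: smallest_sigma_algebra.
move=> X; rewrite -bigcup_seq => -[i _ [A mA <-]].
apply: sub_sigma_algebra; exists (fun j => if j == i then A else setT); split.
  by move=> j; case: ifP.
apply/seteqP; split => t /=; first by move=> [_ At] j; case: eqP => [->|].
by move=> At; split => //; have := At i; rewrite eqxx.
Qed.

(** Rectangles form a pi-system that generates the measurable sets of tuples. *)
Lemma measure_unique_rectangle (m1 m2 : {measure set (n.-tuple T) -> \bar R}) :
  (forall A : 'I_n -> set T, (forall i, measurable (A i)) ->
     m1 [set t | forall i, A i (tnth t i)] =
     m2 [set t | forall i, A i (tnth t i)]) ->
  (m1 setT < +oo)%E -> forall X, measurable X -> m1 X = m2 X.
Proof.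
move=> m12 m1oo X mX.
apply: (measure_unique rectangles (fun=> setT)) => //.
- exact: measurable_tupleE.
- exact: setI_rectangles.
- by move=> _; exists (fun=> setT); split => //; apply/seteqP; split.
- exact: bigcup_const.
- by move=> _ [A [mA ->]]; exact: m12.
Qed.

End rectangles.

(** * Counts of a Poisson process *)

(** The mass at [n + 1], multiplied by [n + 1], is [r] times the mass at [n]. *)
Lemma poisson_mean (R : realType) (r : R) : 0 <= r ->
  (\esum_(n in [set: nat]) (n%:R%:E * poisson_prob r 0 [set n]) = r%:E)%E.
Proof.
rewrite le_eqVlt => /predU1P[<-|r0].
  rewrite esum1// => -[|n] _; first by rewrite mul0e.
  by rewrite /poisson_prob ltxx diracE memNset ?mule0.
have pE n : poisson_prob r 0 [set n] = (poisson_pmf r n)%:E.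
  by rewrite /poisson_prob r0 esum_set1// lee_fin poisson_pmf_ge0.
under eq_esum do rewrite pE -EFinM.
have t0 n : 0 <= n%:R * poisson_pmf r n by rewrite mulr_ge0// poisson_pmf_ge0.
rewrite (esumID [set 0%N]) => [|n _]; last by rewrite lee_fin.
rewrite setTI esum_set1 ?lee_fin// mul0r add0e.
rewrite (_ : _ `&` _ = S @` setT); last first.
  rewrite setTI; apply/seteqP; split => [[|n]//= _|_ [n _ <-]//].
  by exists n.
rewrite esum_image; last by move=> m n _ _ [].
transitivity (\esum_(n in [set: nat]) (r%:E * (poisson_pmf r n)%:E))%E.
  apply: eq_esum => n _; rewrite -EFinM; congr EFin.
  rewrite /poisson_pmf r0 factS natrM exprS invfM.
  have := pnatr_eq0 R n.+1; move: (n.+1%:R) => c /= c0.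
  by field; rewrite c0 pnatr_eq0 -lt0n fact_gt0.
rewrite esumZl ?lee_fin ?ltW// => [|n]; last by rewrite lee_fin poisson_pmf_ge0.
transitivity (r%:E * poisson_prob r 0 setT)%E; first by rewrite /poisson_prob r0.
by rewrite -[RHS]mule1; congr *%E; exact: probability_setT.
Qed.

Section enumerated_points.
Context {R : realType} {d : nat} {disp : measure_display}.
Context {Omega : measurableType disp} (P : probability Omega R).
Variables (omega : Omega -> set (d.-tuple R)) (x y : d.-tuple R).
Variables (D : nat -> set Omega) (v : nat -> Omega -> d.-tuple R).
Hypothesis vD : vertex_enum omega x y D v.
Local Open Scope ereal_scope.

Definition hit (B : set (d.-tuple R)) (n : nat) : set Omega :=
  [set w | [/\ (2 <= n)%N, D n w & B (v n w)]].

Definition point_count (B : set (d.-tuple R)) (w : Omega) : \bar R :=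
  \esum_(n in [set: nat]) (\1_(hit B n) w)%:E.

Lemma measurable_hit B n : measurable B -> measurable (hit B n).
Proof.
move=> mB; have [n2|n2] := boolP (2 <= n)%N; last first.
  rewrite (_ : hit _ _ = set0)//; apply/seteqP; split => w //=.
  by rewrite /hit/= (negbTE n2) => -[].
rewrite (_ : hit _ _ = D n `&` v n @^-1` B); last first.
  by apply/seteqP; split => w /= [].
by case: vD => mD mv _ _ _ _; exact: mv.
Qed.

Lemma point_countE B w : point_count B w = \esum_(a in omega w `&` B) 1.
Proof.
rewrite (_ : omega w `&` B = v ^~ w @` [set n | hit B n w]); last first.
  rewrite (ve_points vD); apply/seteqP; split => a /=.
    by move=> [[n [n2 Dn <-]] Ba]; exists n.
  by move=> [n [n2 Dn Bn] <-]; split => //; exists n.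
rewrite esum_image; last first.
  move=> m n /set_mem[m2 Dm _] /set_mem[n2 Dn _] /= vmn.
  by case: vD => _ _ _ _ _ vI; exact: vI vmn.
rewrite esum_mkcond; apply: eq_esum => n _; rewrite indicE.
by rewrite [in LHS](_ : (w \in hit B n) = (n \in [set n | hit B n w]))//; case: ifPn.
Qed.

Definition bounded_region (B : set (d.-tuple R)) :=
  exists a (r : R), B `<=` [set b | (eucl_dist a b <= r)%R].

Section poisson.
Context (Lambda : set (d.-tuple R) -> \bar R).
Hypothesis pp : poisson_process P Lambda omega.

Lemma count_eventE B k w : bounded_region B ->
  count_event omega B k w <-> point_count B w = k%:R%:E.
Proof.
move=> [a [r Br]]; rewrite point_countE; apply: finite_esum1.
apply: sub_finite_set (pp_locally_finite pp w a r).
by move=> b [? /Br].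
Qed.

(** Exactly one term is nonzero. This is the form to which the law of the counts
    applies. *)
Lemma point_count_sum B w : bounded_region B ->
  point_count B w = \esum_(k in [set: nat]) (k%:R%:E * (\1_(count_event omega B k) w)%:E).
Proof.
move=> bB; have [k Bk] : exists k, count_event omega B k w.
  case: bB => a [r Br]; apply/finite_setP.
  apply: sub_finite_set (pp_locally_finite pp w a r).
  by move=> b [? /Br].
have Nk := (count_eventE k w bB).1 Bk.
rewrite (esumID [set k]) => [|n _]; last first.
  by rewrite mule_ge0// lee_fin.
rewrite setTI esum_set1; last by rewrite mule_ge0// lee_fin.
rewrite indicE mem_set// mule1 Nk esum1 ?adde0// => n [_ /= nk].
rewrite indicE memNset ?mule0// => /(count_eventE _ _ bB).
by rewrite Nk => -[] /eqP; rewrite eqr_nat => /eqP kn; apply: nk.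
Qed.

(** Expanding each count over its values turns the product into a sum over joint
    values, whose probabilities factor by independence. *)
Lemma expectation_prod_point_count k (B : 'I_k -> set (d.-tuple R)) :
  (forall i, measurable (B i)) -> (forall i, bounded_region (B i)) ->
  (forall i, 0 <= Lambda (B i) < +oo) -> trivIset setT B ->
  \int[P]_w (\prod_(i < k) point_count (B i) w) = \prod_(i < k) Lambda (B i).
Proof.
move=> mB bB LB tB.
pose c i (n : nat) w : \bar R := n%:R%:E * (\1_(count_event omega (B i) n) w)%:E.
have c0 i n w : 0 <= c i n w by rewrite mule_ge0// lee_fin.
have mc i n : measurable_fun setT (c i n).
  apply: measurable_funeM; apply/measurable_EFinP; apply: measurable_indic.
  exact: pp_measurable pp _ _ _.
transitivity (\int[P]_w \esum_(t in [set: k.-tuple nat])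
    \prod_(i < k) c i (tnth t i) w).
  apply: eq_integral => w _; rewrite (@esum_tuple_prod _ _ (fun i n => c i n w))//.
  by apply: eq_bigr => i _; exact: point_count_sum.
rewrite integral_esum; last 2 first.
- by move=> t; apply: emeasurable_prod => i; exact: mc.
- by move=> t w; exact: prode_ge0.
transitivity (\esum_(t in [set: k.-tuple nat]) \prod_(i < k)
    ((tnth t i)%:R%:E * P (count_event omega (B i) (tnth t i)))).
  apply: eq_esum => t _.
  under eq_integral do rewrite big_split/= prode_indic.
  have mE : measurable (\bigcap_i count_event omega (B i) (tnth t i)).
    by apply: fin_bigcap_measurable => // i _; exact: pp_measurable pp _ _ _.
  rewrite ge0_integralZl//; last 2 first.
  - by apply/measurable_EFinP; exact: measurable_indic.
  - by apply: prode_ge0 => i _; rewrite lee_fin.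
  by rewrite (integral_indic _ measurableT mE) setIT big_split/= (pp_independent pp).
rewrite (@esum_tuple_prod _ _ (fun i n =>
  n%:R%:E * P (count_event omega (B i) n))); last first.
  by move=> i n; rewrite mule_ge0// lee_fin.
apply: eq_bigr => i _; have /andP[L0 Loo] := LB i.
under eq_esum do rewrite (pp_poisson pp)//.
rewrite poisson_mean ?fine_ge0// fineK// ge0_fin_numE//.
Qed.

End poisson.
End enumerated_points.

(** * Cells of a grid of the space *)

Section grid.
Context {R : realType} {d : nat}.
Implicit Types (a b : d.-tuple R) (n : nat).

(** The grid of level [n] has mesh [1 / (n + 1)]. The grids are not nested, but two
    distinct points lie in different cells of all grids that are fine enough. *)
Definition cell_index n b : d.-tuple int :=
  [tuple Num.floor (n.+1%:R * tnth b i) | i < d].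

Definition cell n (z : d.-tuple int) : set (d.-tuple R) :=
  [set b | cell_index n b = z].

Definition grid_itv n (m : int) : set R :=
  `[m%:~R / n.+1%:R, (m + 1)%:~R / n.+1%:R[%classic.

Lemma grid_itvE n m r : grid_itv n m r = (Num.floor (n.+1%:R * r) == m).
Proof.
have n0 : 0 < n.+1%:R :> R by rewrite ltr0n.
rewrite /grid_itv/= in_itv/= floor_eq ler_pdivrMr// ltr_pdivlMr//.
by rewrite ![r * n.+1%:R]mulrC.
Qed.

Lemma cell_rectangle n z :
  cell n z = [set b | forall i, grid_itv n (tnth z i) (tnth b i)].
Proof.
apply/seteqP; split => b /=.
  by move=> <- i; rewrite grid_itvE tnth_mktuple.
move=> bz; apply/eq_from_tnth => i; apply/eqP.
by have := bz i; rewrite grid_itvE tnth_mktuple.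
Qed.

Lemma measurable_cell n z : measurable (cell n z).
Proof.
rewrite cell_rectangle.
apply: (@measurable_rectangle _ _ d (fun i => grid_itv n (tnth z i))) => i.
exact: measurable_itv.
Qed.

Lemma lebesgue_cell n z : (lebesgue_tuple R d (cell n z) < +oo)%E.
Proof.
rewrite cell_rectangle (@lebesgue_tupleE _ _ (fun i => grid_itv n (tnth z i))); last first.
  by move=> i; exact: measurable_itv.
have h m : (0 <= lebesgue_measure (grid_itv n m) < +oo)%E.
  by rewrite measure_ge0 lebesgue_measure_itv/=; case: ifP => _; rewrite ltry.
have /andP[_ //] : (0 <= \prod_(i < d) lebesgue_measure (grid_itv n (tnth z i)) < +oo)%E.
elim/big_ind : _ => // [|a b /andP[a0 a1] /andP[b0 b1]]; first by rewrite lee01 ltry.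
by rewrite mule_ge0// lte_mul_pinfty// ge0_fin_numE.
Qed.

Lemma bounded_cell n z : exists a (r : R), cell n z `<=` [set b | eucl_dist a b <= r].
Proof.
exists [tuple (tnth z i)%:~R / n.+1%:R | i < d], (Num.sqrt d%:R) => b.
rewrite cell_rectangle /= => zb; rewrite ler_sqrt ?ler0n//.
rewrite -[leRHS]mulr1 -[X in _ <= X%:R * _](card_ord d) mulr_natl -sumr_const.
apply: ler_sum => i _; rewrite tnth_mktuple.
have := zb i; rewrite /grid_itv/= in_itv/= intrD mulrDl mulr1z => /andP[zi bi].
have n0 : 1 / n.+1%:R <= 1 :> R by rewrite ler_pdivrMr ?ltr0n// mul1r ler1n.
move: zi bi n0; set e := _ / _; set u := _ / _; set c := tnth b i => zi bi n0.
suff : -1 <= u - c /\ u - c <= 0 by move=> [] ? ?; nra.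
by split; lra.
Qed.

(** Two reals with the same integer part after multiplication by [n + 1] differ by less
    than [1 / (n + 1)]. *)
Lemma cells_separate k (t : k.-tuple (d.-tuple R)) : uniq t ->
  exists n, uniq [seq cell_index n b | b <- t].
Proof.
move=> ut.
have sep a b : a != b -> \forall n \near \oo, cell_index n a != cell_index n b.
  move=> ab; have [i abi] : exists i, tnth a i != tnth b i.
    apply/existsP; apply: contraNT ab; rewrite negb_exists => /forallP ab.
    by apply/eqP/eq_from_tnth => i; apply/eqP; move: (ab i); rewrite negbK.
  have e0 : 0 < `|tnth a i - tnth b i| by rewrite normr_gt0 subr_eq0.
  near=> n; apply/negP => /eqP /(congr1 (fun z => tnth z i)); rewrite !tnth_mktuple => fab.
  have n1 : `|tnth a i - tnth b i|^-1 <= n.+1%:R.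
    by rewrite (le_trans (ltW (truncnS_gt _)))// ler_nat ltnS; near: n; exact: nbhs_infty_ge.
  have : `|n.+1%:R * tnth a i - n.+1%:R * tnth b i| < 1.
    have /andP[] := floor_itv (n.+1%:R * tnth a i).
    have /andP[] := floor_itv (n.+1%:R * tnth b i).
    by rewrite fab !intrD ltr_norml; lra.
  rewrite -mulrBr normrM normr_nat ltNge => /negP; apply.
  by rewrite -ler_pdivrMr// div1r.
have : \forall n \near \oo, forall ij : 'I_k * 'I_k, ij.1 != ij.2 ->
    cell_index n (tnth t ij.1) != cell_index n (tnth t ij.2).
  apply: filter_forall => -[i j] /=; have [->|ij] := eqVneq i j.
    by near=> n.
  have tij : tnth t i != tnth t j by apply: contra ij => /eqP /(tuple_uniqP _ ut) ->.
  by apply: filterS (sep _ _ tij) => n.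
move=> [n _ /(_ n (leqnn n)) h]; exists n.
rewrite (_ : [seq _ | b <- t] = [tuple of [seq cell_index n b | b <- t]])//.
apply/tuple_uniqP => i j; rewrite !tnth_map => eij.
by apply/eqP; apply: contraT => /(h (i, j)); rewrite eij eqxx.
Unshelve. all: by end_near.
Qed.
End grid.

Lemma measurable_diagonal (R : realType) d :
  measurable [set p : d.-tuple R * d.-tuple R | p.1 = p.2].
Proof.
rewrite (_ : [set _ | _] = \bigcap_(i in [set: 'I_d])
    [set p : d.-tuple R * d.-tuple R | tnth p.1 i == tnth p.2 i]); last first.
  apply/seteqP; split => -[a b] /=; first by move=> -> i _; rewrite /= eqxx.
  by move=> ab; apply/eq_from_tnth => i; apply/eqP; exact: ab.
apply: fin_bigcap_measurable => // i _.
have m1 : measurable_fun setT (fun p : d.-tuple R * d.-tuple R => tnth p.1 i).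
  exact: measurableT_comp (measurable_tnth i) measurable_fst.
have m2 : measurable_fun setT (fun p : d.-tuple R * d.-tuple R => tnth p.2 i).
  exact: measurableT_comp (measurable_tnth i) measurable_snd.
by have := measurable_fun_eqr m1 m2 measurableT (Y := [set true]) I; rewrite setTI.
Qed.

Lemma lebesgue_tuple1 (R : realType) d (a : d.-tuple R) : (0 < d)%N ->
  lebesgue_tuple R d [set a] = 0%E.
Proof.
case: d a => // d a _.
rewrite (_ : [set a] = [set t | forall i, [set tnth a i] (tnth t i)]).
  rewrite (@lebesgue_tupleE _ _ (fun i => [set tnth a i])) => [|i]; last exact: measurable_set1.
  by rewrite big_ord_recl lebesgue_measure_set1 mul0e.
by apply/seteqP; split => [_ -> //|t ta]; apply/eq_from_tnth.
Qed.

(** * Factorial moment measures of a Poisson process *)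

Lemma integral_mrestr d (T : measurableType d) (R : realType)
    (m : {measure set T -> \bar R}) (A : set T) (mA : measurable A)
    (f : T -> \bar R) : measurable_fun setT f -> (forall t, 0 <= f t)%E ->
  (\int[mrestr m mA]_t f t = \int[m]_(t in A) f t)%E.
Proof.
move=> mf f0; rewrite -(setUv A) ge0_integral_setU//=; last 3 first.
- exact: measurableC.
- by rewrite setUv.
- exact/disj_setPCl.
rewrite [X in (_ + X)%E](_ : _ = 0)%E ?adde0.
  apply: eq_measure_integral => B mB BA.
  by rewrite /mrestr/=; congr (m _); apply/setIidl.
rewrite -(@integral_measure_zero _ _ _ (~` A) f).
apply: eq_measure_integral => B mB BA.
have BA0 : B `&` A = set0 by apply/seteqP; split => t // -[/BA].
by rewrite /= /mrestr BA0 measure0.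
Qed.

Section moment_measure.
Context {R : realType} {d : nat} {disp : measure_display}.
Context {Omega : measurableType disp} (P : probability Omega R).
Variables (omega : Omega -> set (d.-tuple R)) (x y : d.-tuple R).
Variables (D : nat -> set Omega) (v : nat -> Omega -> d.-tuple R).
Hypothesis vD : vertex_enum omega x y D v.
Local Open Scope ereal_scope.

(** The vertices are enumerated by partial functions; they are made total by an
    arbitrary default value outside their domain. *)
Definition vertex (n : nat) (w : Omega) : d.-tuple R :=
  if w \in D n then v n w else x.

Definition present k (t : k.-tuple nat) : set Omega :=
  \bigcap_(i in [set: 'I_k]) D (tnth t i).

Definition vertices k (t : k.-tuple nat) (w : Omega) : k.-tuple (d.-tuple R) :=
  [tuple vertex (tnth t i) w | i < k].

Lemma measurable_vertex n : measurable_fun setT (vertex n).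
Proof.
case: vD => mD mv _ _ _ _; rewrite -(setUv (D n)).
apply/measurable_funU => //; first exact: measurableC.
split.
  apply: eq_measurable_fun (mv n) => w Dw.
  by rewrite /vertex Dw.
apply: eq_measurable_fun (@measurable_cst _ _ _ _ _ x) => w Dw.
by rewrite /vertex ifN// -in_setC.
Qed.

Lemma measurable_present k (t : k.-tuple nat) : measurable (present t).
Proof.
by apply: fin_bigcap_measurable => // i _; case: vD.
Qed.

Lemma measurable_vertices k (t : k.-tuple nat) :
  measurable_fun setT (vertices t).
Proof.
apply/measurable_fun_tnthP => i.
rewrite (_ : _ \o _ = vertex (tnth t i)); first exact: measurable_vertex.
by apply/funext => w; rewrite /= tnth_mktuple.
Qed.

(** The indices 0 and 1 are those of the endpoints: prepending them makes uniqueness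
    say both that the indices are distinct and that they are at least 2. *)
Definition admissible k (t : k.-tuple nat) := uniq [:: 0, 1 & t]%N.

Definition moment_term k (t : k.-tuple nat) :
    {measure set (k.-tuple (d.-tuple R)) -> \bar R} :=
  if admissible t then
    pushforward_measure (mrestr P (measurable_present t)) (measurable_vertices t)
  else mzero.

(** The sum, over all sequences of [k] distinct indices, of the laws of the sequences
    of points that they enumerate; the summands are indexed by natural numbers. *)
Definition moment_measure k : {measure set (k.-tuple (d.-tuple R)) -> \bar R} :=
  mseries (fun n => oapp (@moment_term k) mzero (pickle_inv n)) 0.

Lemma moment_measureE k (A : set (k.-tuple (d.-tuple R))) :
  measurable A ->
  moment_measure k A = \esum_(t in [set t | admissible t])
    P (vertices t @^-1` A `&` present t).
Proof.
move=> mA; rewrite esum_mkcond esum_pickle; last by move=> t; case: ifP.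
apply: eq_eseriesr => n _; case: pickle_inv => [t|]//=.
have -> : (t \in [set t | admissible t]) = admissible t by apply/idP/idP; rewrite inE.
by rewrite /moment_term; case: ifP.
Qed.

Lemma integral_moment_measure k (f : k.-tuple (d.-tuple R) -> \bar R) :
  measurable_fun setT f -> (forall t, 0 <= f t) ->
  \int[moment_measure k]_a f a = \esum_(t in [set t | admissible t])
    \int[P]_(w in present t) f (vertices t w).
Proof.
move=> mf f0; rewrite esum_mkcond esum_pickle; last first.
  by move=> t; case: ifP => // _; exact: integral_ge0.
rewrite ge0_integral_measure_series//.
apply: eq_eseriesr => n _; case: pickle_inv => [t|]/=; last first.
  exact: integral_measure_zero.
have -> : (t \in [set t | admissible t]) = admissible t by apply/idP/idP; rewrite inE.
rewrite /moment_term; case: ifP => _; last exact: integral_measure_zero.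
rewrite (ge0_integral_pushforward (measurable_vertices t))//.
rewrite preimage_setT integral_mrestr//=.
exact: measurableT_comp mf (measurable_vertices t).
Qed.

End moment_measure.

Section factorial_moment.
Context {R : realType} {d : nat} {disp : measure_display}.
Context {Omega : measurableType disp} (P : probability Omega R).
Variables (omega : Omega -> set (d.-tuple R)) (x y : d.-tuple R).
Variables (D : nat -> set Omega) (v : nat -> Omega -> d.-tuple R).
Hypothesis vD : vertex_enum omega x y D v.
Variable lambda : R.
Hypothesis lambda0 : 0 <= lambda.
Local Notation mu := (lebesgue_tuple R d).
Hypothesis pp : poisson_process P (fun B => lambda%:E * mu B)%E omega.
Local Open Scope ereal_scope.

Lemma admissible_ge2 k (t : k.-tuple nat) : admissible t ->
  forall i, (2 <= tnth t i)%N.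
Proof.
rewrite /admissible /= !inE !negb_or => /and3P[/andP[_ t0] t1 _] i.
have ti := mem_tnth i t; case E : (tnth t i) ti => [|[|n]]// ti.
  by rewrite ti in t0.
by rewrite ti in t1.
Qed.

Lemma admissibleP k (t : k.-tuple nat) : (forall i, (2 <= tnth t i)%N) -> uniq t ->
  admissible t.
Proof.
move=> t2 ut; have nt n : (n < 2)%N -> n \notin (t : seq nat).
  by move=> n2; apply/negP => /tnthP[i ni]; have := t2 i; rewrite -ni leqNgt n2.
by rewrite /admissible /= inE !nt.
Qed.

(** As the sides are disjoint, points in different sides have different indices, and
    the sum over sequences of indices factors into a product of counts. *)
Lemma moment_rectangle k (B : 'I_k -> set (d.-tuple R)) :
  (forall i, measurable (B i)) -> (forall i, bounded_region (B i)) ->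
  (forall i, mu (B i) < +oo) -> trivIset setT B ->
  moment_measure P vD k [set a | forall i, B i (tnth a i)] =
  \prod_(i < k) (lambda%:E * mu (B i)).
Proof.
move=> mB bB muB tB.
rewrite -(expectation_prod_point_count vD pp)//; last first.
  move=> i; rewrite mule_ge0//= lte_mul_pinfty// ?lee_fin//.
under eq_integral do rewrite -(@esum_tuple_prod _ _ (fun i n => (\1_(hit D v (B i) n) _)%:E))//.
rewrite integral_esum; last 2 first.
- move=> t; apply: emeasurable_prod => i; apply/measurable_EFinP.
  by apply: measurable_indic; exact: (measurable_hit vD).
- by move=> t w; apply: prode_ge0 => i _; rewrite lee_fin.
rewrite moment_measureE; last exact: measurable_rectangle.
rewrite esum_mkcond; apply: eq_esum => t _.
under eq_integral do rewrite prode_indic.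
rewrite (integral_indic _ measurableT) ?setIT; last first.
  by apply: fin_bigcap_measurable => // i _; exact: (measurable_hit vD).
case: ifPn => [/set_mem/= pt|npt].
  congr (P _); apply/seteqP; split => w /=.
    move=> [h Dt] i _; split; [exact: admissible_ge2|exact: Dt|].
    by have := h i; rewrite tnth_mktuple /vertex mem_set//; exact: Dt.
  move=> h; split => [i|i _]; last by case: (h i I).
  by rewrite tnth_mktuple /vertex; have [_ Dt Bi] := h i I; rewrite mem_set.
suff -> : \bigcap_i hit D v (B i) (tnth t i) = set0 by rewrite measure0.
apply/seteqP; split => // w /= h.
move: npt; rewrite notin_setE/=; apply; apply: admissibleP.
  by move=> i; case: (h i I).
apply/tuple_uniqP => i j tij; apply: (tB i j) => //; exists (v (tnth t i) w); split.
  by case: (h i I).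
by rewrite tij; case: (h j I).
Qed.

(** Inside a product of distinct cells, all rectangles have disjoint sides. *)
Lemma moment_cell k n (z : k.-tuple (d.-tuple int)) (A : set (k.-tuple (d.-tuple R))) :
  uniq z -> measurable A ->
  let C := [set a | forall i, cell n (tnth z i) (tnth a i)] in
  moment_measure P vD k (A `&` C) = (lambda ^+ k)%:E * power_measure mu k (A `&` C).
Proof.
move=> uz mA C.
have mC : measurable C.
  apply: (@measurable_rectangle _ _ k (fun i => cell n (tnth z i))) => i.
  exact: measurable_cell.
have lk : (0 <= lambda ^+ k)%R by rewrite exprn_ge0.
pose m := mscale (NngNum lk) (power_measure mu k).
have mE X : m X = (lambda ^+ k)%:E * power_measure mu k X by [].
have agree (B : 'I_k -> set (d.-tuple R)) : (forall i, measurable (B i)) ->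
    moment_measure P vD k ([set a | forall i, B i (tnth a i)] `&` C) =
    m ([set a | forall i, B i (tnth a i)] `&` C).
  move=> mB; rewrite mE.
  rewrite (_ : _ `&` _ = [set a | forall i, (B i `&` cell n (tnth z i)) (tnth a i)]); last first.
    apply/seteqP; split => a /=; first by move=> [Ba Ca] i; split; [exact: Ba|exact: Ca].
    by move=> BC; split => i; case: (BC i).
  have mBC i : measurable (B i `&` cell n (tnth z i)).
    by apply: measurableI => //; exact: measurable_cell.
  rewrite (@moment_rectangle k (fun i => B i `&` cell n (tnth z i)))//.
  - rewrite (@power_measure_rectangle _ _ _ mu k (fun i => B i `&` cell n (tnth z i)))//.
    by rewrite big_split/= prodEFin prodr_const card_ord.
  - move=> i; have [a [r zr]] := @bounded_cell R _ n (tnth z i).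
    by exists a, r => b [_ /zr].
  - move=> i; apply: le_lt_trans (lebesgue_cell n (tnth z i)).
    by apply: le_measure; rewrite ?inE//; exact: measurable_cell.
  - move=> i j _ _ [a [[_ zi] [_ zj]]]; apply: (tuple_uniqP _ uz).
    by rewrite -zi -zj.
have Coo : m C < +oo.
  rewrite mE (@power_measure_rectangle _ _ _ mu k (fun i => cell n (tnth z i))); last first.
    by move=> i; exact: measurable_cell.
  rewrite lte_mul_pinfty//.
  have /andP[_ //] : 0 <= \prod_(i < k) mu (cell n (tnth z i)) < +oo.
  elim/big_ind : _ => // [|a b /andP[a0 a1] /andP[b0 b1]|i _]; first by rewrite lee01 ltry.
    by rewrite mule_ge0// lte_mul_pinfty// ge0_fin_numE.
  by rewrite measure_ge0 lebesgue_cell.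
apply: (measure_unique_rectangle (m1 := mrestr (moment_measure P vD k) mC)
  (m2 := mrestr m mC)) => //.
have := agree (fun=> setT) (fun=> measurableT).
rewrite /= /mrestr (_ : [set a | _] = setT)//; last by apply/seteqP; split.
by move=> ->; rewrite setTI.
Qed.

(** Independence of the counts gives the equality on products of pairwise disjoint
    regions only, but these generate the measurable sets of sequences of distinct
    points, and neither measure charges the diagonals. *)
Lemma moment_measure_lebesgue k (A : set (k.-tuple (d.-tuple R))) : (0 < d)%N ->
  measurable A ->
  moment_measure P vD k A = (lambda ^+ k)%:E * power_measure mu k A.
Proof.
move=> d0 mA.
have mU : measurable [set a : k.-tuple (d.-tuple R) | ~~ uniq a].
  rewrite [X in measurable X](_ : _ = ~` [set a : k.-tuple (d.-tuple R) | uniq a]).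
    by apply: measurableC; apply: measurable_uniq; exact: measurable_diagonal.
  by apply/seteqP; split => a /= /negP.
have lk : (0 <= lambda ^+ k)%R by rewrite exprn_ge0.
pose m := mscale (NngNum lk) (power_measure mu k).
(* The whole space is covered by the diagonals and by the products of distinct
   cells of a common grid. *)
pose g (j : nat) : set (k.-tuple (d.-tuple R)) :=
  if j is j'.+1 then
    if pickle_inv j' is Some (n, z) then
      if uniq (z : k.-tuple (d.-tuple int)) then [set a | forall i, cell n (tnth z i) (tnth a i)]
      else set0
    else set0
  else [set a : k.-tuple (d.-tuple R) | ~~ uniq a].
rewrite -[RHS]/(m A).
apply: (@g_sigma_algebra_measure_unique_cover _ _ _ measurable _ g) => //.
- case=> [|j] //=; case: pickle_inv => // -[n z]; case: ifP => // _.
  apply: (@measurable_rectangle _ _ k (fun i => cell n (tnth z i))) => i.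
  exact: measurable_cell.
- rewrite -subTset => a _; have [ua|ua] := boolP (uniq a); last by exists 0%N.
  have [n un] := cells_separate ua.
  exists (pickle (n, [tuple of [seq cell_index n b | b <- a]])).+1 => //=.
  by rewrite pickleK_inv/= un => i; rewrite tnth_map.
- move=> j B; rewrite sigma_algebra_id; last exact: sigma_algebra_measurable.
  move=> mB; case: j => [|j] /=; last first.
    case: (pickle_inv j) => [[n z]|]; last by rewrite set0I !measure0.
    case: ifPn => uz; last by rewrite set0I !measure0.
    by rewrite setIC; exact: moment_cell.
  transitivity (0 : \bar R); last apply/esym.
    rewrite moment_measureE; last exact: measurableI.
    rewrite esum1// => t pt.
    rewrite (_ : _ `&` _ = set0) ?measure0//; apply/seteqP.
    split => // w [[/negP nu _] Dt]; apply: nu.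
    apply/tuple_uniqP => i i'; rewrite !tnth_mktuple.
    rewrite /vertex !mem_set; [|exact: Dt|exact: Dt] => vii.
    have : tnth t i = tnth t i'.
      by case: vD => _ _ _ _ _ vI; apply: vI vii; rewrite ?admissible_ge2//; exact: Dt.
    by apply/tuple_uniqP; move: pt; rewrite /= /admissible /= => /and3P[].
  apply/eqP; rewrite eq_le measure_ge0 andbT.
  apply: (@le_trans _ _ (m [set a : k.-tuple (d.-tuple R) | ~~ uniq a])).
    by apply: le_measure; rewrite ?inE//; exact: measurableI.
  rewrite /m /mscale/= power_measure_diagonal ?mule0//; first exact: measurable_diagonal.
  by move=> a; exact: lebesgue_tuple1.
- by rewrite sigma_algebra_id//; exact: sigma_algebra_measurable.
Qed.

End factorial_moment.

(** * Expected number of copies of a graph *)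

Lemma measurable_nth d (T : measurableType d) k (x : T) (s : seq T) i :
  measurable_fun setT (fun a : k.-tuple T => nth x (s ++ a) i).
Proof.
have [ilt|ige] := ltnP i (size s).
  under eq_fun do rewrite nth_cat ilt; exact: measurable_cst.
under eq_fun do rewrite nth_cat ltnNge ige /=.
have [jlt|jge] := ltnP (i - size s) k.
  under eq_fun do rewrite -(tnth_nth x _ (Ordinal jlt)).
  exact: measurable_tnth.
under eq_fun do rewrite nth_default ?size_tuple//.
exact: measurable_cst.
Qed.

Section subgraph.
Context {R : realType} {d : nat} {disp : measure_display}.
Context {Omega : measurableType disp} (P : probability Omega R).
Variables (omega : Omega -> set (d.-tuple R)) (x y : d.-tuple R).
Variable edge : Omega -> d.-tuple R -> d.-tuple R -> Prop.
Hypothesis edgeC : forall w a b, edge w a b -> edge w b a.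
Variable H : d.-tuple R -> d.-tuple R -> R.
Hypothesis HC : forall a b, H a b = H b a.
Hypothesis H0 : forall a b, 0 <= H a b.
Hypothesis mH : measurable_fun setT (fun p => H p.1 p.2).
Variables (D : nat -> set Omega) (v : nat -> Omega -> d.-tuple R).
Hypothesis vD : vertex_enum omega x y D v.
Hypothesis edge_cond : forall (F : {fset nat * nat}) (A : set Omega),
  (forall e, e \in F -> (e.1 < e.2)%N) -> vertex_sigma D v A ->
  (forall e, e \in F -> A `<=` D e.1 `&` D e.2) ->
  P (A `&` [set w | forall e, e \in F -> edge w (v e.1 w) (v e.2 w)]) =
  (\int[P]_(w in A) (\prod_(e <- F) H (v e.1 w) (v e.2 w))%:E)%E.
Variable lambda : R.
Hypothesis lambda0 : 0 <= lambda.
Local Notation mu := (lebesgue_tuple R d).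
Hypothesis pp : poisson_process P (fun B => lambda%:E * mu B)%E omega.
Hypothesis d0 : (0 < d)%N.

Definition all_edges (es : seq (nat * nat)) : set Omega :=
  [set w | forall e, e \in es -> edge w (v e.1 w) (v e.2 w)].

(** The model indexes edges by increasing pairs. *)
Definition ordered_edge (e : nat * nat) := if (e.1 < e.2)%N then e else (e.2, e.1).

Lemma all_edges_prob (es : seq (nat * nat)) (A : set Omega) :
  (forall e, e \in es -> e.1 != e.2) -> uniq (map ordered_edge es) ->
  vertex_sigma D v A -> (forall e, e \in es -> A `<=` D e.1 `&` D e.2) ->
  P (A `&` all_edges es) =
  (\int[P]_(w in A) (\prod_(e <- es) H (v e.1 w) (v e.2 w))%:E)%E.
Proof.
move=> neq ues sA AD; pose F := [fset e in map ordered_edge es]%fset.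
have FP e : e \in F -> exists2 e', e' \in es & e = ordered_edge e'.
  by rewrite inE => /mapP[e' ? ?]; exists e'.
have perm_F : perm_eq F (map ordered_edge es).
  by apply: uniq_perm => // e; rewrite inE.
have := @edge_cond F A; rewrite -[X in P X = _](_ : A `&` all_edges es = _); last first.
  congr setI; apply/seteqP; split => w /= h e.
    move=> /FP[e' /h he' ->]; rewrite /ordered_edge; case: ifP => //= _.
    exact: edgeC.
  move=> ees; have /h : ordered_edge e \in F by rewrite inE map_f.
  by rewrite /ordered_edge; case: ifP => //= _; exact: edgeC.
move=> ->//; last 2 first.
- move=> e /FP[e' e's ->]; rewrite /ordered_edge; case: ifPn => //=.
  rewrite -leqNgt leq_eqVlt => /predU1P[ee|//].
  by have := neq _ e's; rewrite ee eqxx.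
- move=> e /FP[e' /AD e's ->] w Aw; rewrite /ordered_edge; case: ifP => _ /=; first exact: e's.
  by split; case: (e's w Aw).
apply: eq_integral => w _; congr EFin.
rewrite (perm_big _ perm_F)/= big_map; apply: eq_bigr => e _.
by rewrite /ordered_edge; case: ifP => //= _; rewrite HC.
Qed.

(** Graphs on the labels 0 and 1, which stand for the two endpoints, and 2, ..., k + 1,
    which stand for points of the process. *)
Definition graph_on k (es : seq (nat * nat)) :=
  uniq es && all (fun e => (e.1 < e.2 < k.+2)%N) es.

Definition index_of k (t : k.-tuple nat) (a : nat) : nat := nth 0%N [:: 0, 1 & t]%N a.

Definition graph_copy k (es : seq (nat * nat)) (t : k.-tuple nat) : set Omega :=
  present D t `&` all_edges [seq (index_of t e.1, index_of t e.2) | e <- es].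

Definition weight k (es : seq (nat * nat)) (a : k.-tuple (d.-tuple R)) : R :=
  \prod_(e <- es) H (nth x [:: x, y & a] e.1) (nth x [:: x, y & a] e.2).

Lemma weight_ge0 k es a : 0 <= @weight k es a.
Proof. by apply: prodr_ge0 => e _; exact: H0. Qed.

Lemma measurable_weight k es : measurable_fun setT (@weight k es).
Proof.
apply: measurable_prod => e _.
have := @measurable_fun_pair _ _ _ _ _ _ _ _ (@measurable_nth _ _ k x [:: x; y] e.1)
  (@measurable_nth _ _ k x [:: x; y] e.2).
exact: measurableT_comp mH.
Qed.

Lemma vertex_sigma_present k (t : k.-tuple nat) : vertex_sigma D v (present D t).
Proof.
apply: (@fin_bigcap_measurable _ (g_sigma_algebraType
  [set A | exists i B, measurable B /\ A = D i `&` v i @^-1` B])) => // i _.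
by apply: sub_sigma_algebra; exists (tnth t i), setT; split => //; rewrite preimage_setT setIT.
Qed.

Lemma index_ofE k (t : k.-tuple nat) w a : present D t w -> (a < k.+2)%N ->
  D (index_of t a) w /\
  v (index_of t a) w = nth x [:: x, y & vertices x D v t w] a.
Proof.
move=> Dt; case: vD => _ _ [D0 v0] [D1 v1] _ _.
case: a => [|[|a]] ak; rewrite /index_of /=; first by rewrite D0 v0.
  by rewrite D1 v1.
rewrite !ltnS in ak; rewrite -(tnth_nth 0%N t (Ordinal ak)).
have Da := Dt (Ordinal ak) I; split => //.
rewrite -[RHS](tnth_nth x (vertices x D v t w) (Ordinal ak)).
by rewrite tnth_mktuple /vertex mem_set.
Qed.

(** Distinct edges of the graph go to distinct pairs of vertices, because the indices
    are distinct; so the edges of a copy are conditionally independent. *)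
Lemma graph_copy_prob k es (t : k.-tuple nat) : graph_on k es -> admissible t ->
  P (graph_copy es t) = (\int[P]_(w in present D t) (weight es (vertices x D v t w))%:E)%E.
Proof.
move=> /andP[ues /allP ges] pt.
have inj a b : (a < k.+2)%N -> (b < k.+2)%N -> index_of t a = index_of t b -> a = b.
  move=> ak bk /eqP; rewrite nth_uniq/= ?size_tuple//; first by move/eqP.
rewrite all_edges_prob; last 4 first.
- move=> _ /mapP[e /ges /andP[e12 e2] ->] /=; apply/eqP => eqi.
  by have := e12; rewrite (inj _ _ (ltn_trans e12 e2) e2 eqi) ltnn.
- rewrite -map_comp map_inj_in_uniq// => -[a b] [a' b'] /ges/andP[/= ab bk].
  move=> /ges/andP[/= ab' bk']; have ak := ltn_trans ab bk; have ak' := ltn_trans ab' bk'.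
  rewrite /ordered_edge/=; case: ifP => _; case: ifP => _ [] eq1 eq2.
  + by rewrite (inj _ _ ak ak' eq1) (inj _ _ bk bk' eq2).
  + by move: ab; rewrite (inj _ _ ak bk' eq1) (inj _ _ bk ak' eq2) ltnNge ltnW.
  + by move: ab; rewrite (inj _ _ bk ak' eq1) (inj _ _ ak bk' eq2) ltnNge ltnW.
  + by rewrite (inj _ _ bk bk' eq1) (inj _ _ ak ak' eq2).
- exact: vertex_sigma_present.
- move=> _ /mapP[e /ges /andP[e12 e2] ->] w Dw /=; split.
    by case: (index_ofE Dw (ltn_trans e12 e2)).
  by case: (index_ofE Dw e2).
apply: eq_integral => w /set_mem Dw; congr EFin; rewrite /weight big_map.
apply: eq_big_seq => e /ges /andP[e12 e2] /=.
by rewrite (index_ofE Dw e2).2 (index_ofE Dw (ltn_trans e12 e2)).2.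
Qed.

Local Open Scope ereal_scope.

(** Given the points, a copy is present with probability the weight of its vertices;
    it remains to sum over the points, that is, to integrate the weight with
    respect to a factorial moment measure. *)
Lemma expected_copies k es : graph_on k es ->
  \esum_(t in [set t : k.-tuple nat | admissible t]) P (graph_copy es t) =
  (lambda ^+ k)%:E * \int[power_measure mu k]_a (weight es a)%:E.
Proof.
move=> ges.
have mw : measurable_fun setT (fun a : k.-tuple (d.-tuple R) => (weight es a)%:E).
  by apply/measurable_EFinP; exact: measurable_weight.
have w0 (a : k.-tuple (d.-tuple R)) : 0 <= (weight es a)%:E.
  by rewrite lee_fin; exact: weight_ge0.
have lk : (0 <= lambda ^+ k)%R by rewrite exprn_ge0.
rewrite -[(lambda ^+ k)%:E]/((NngNum lk)%:num%:E) -ge0_integral_mscale//.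
transitivity (\int[moment_measure P vD k]_a (weight es a)%:E); last first.
  apply: eq_measure_integral => A mA _.
  by rewrite (moment_measure_lebesgue vD lambda0 pp).
rewrite integral_moment_measure//; apply: eq_esum => t pt.
exact: graph_copy_prob.
Qed.

End subgraph.

(** * Gaussian integrals *)

Section rayleigh_theory.
Context {R : realType} {d : nat}.
Implicit Types (a b u w : d.-tuple R) (p q : R).

Lemma eucl_dist2 a b : eucl_dist a b ^+ 2 = \sum_(i < d) (tnth a i - tnth b i) ^+ 2.
Proof. by rewrite sqr_sqrtr//; apply: sumr_ge0 => i _; exact: sqr_ge0. Qed.

Lemma rayleighC p a b : rayleigh p a b = rayleigh p b a.
Proof.
rewrite /rayleigh !eucl_dist2; congr (expR (- (_ * _))).
by apply: eq_bigr => i _; rewrite -sqrrN opprB.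
Qed.

Lemma rayleigh_ge0 p a b : 0 <= rayleigh p a b.
Proof. exact: expR_ge0. Qed.

Lemma rayleighD p q a b : rayleigh p a b * rayleigh q a b = rayleigh (p + q) a b.
Proof. by rewrite /rayleigh -expRD mulrDl opprD. Qed.

Lemma rayleigh_half p a b : rayleigh p a b = rayleigh (p / 2) a b ^+ 2.
Proof. by rewrite expr2 rayleighD -splitr. Qed.

Lemma measurable_rayleigh p :
  measurable_fun setT (fun c : d.-tuple R * d.-tuple R => rayleigh p c.1 c.2).
Proof.
apply: measurableT_comp; first exact: measurable_expR.
apply: measurable_funN.
apply: measurable_funM; first exact: measurable_cst.
rewrite (_ : (fun _ => _) = fun c : d.-tuple R * d.-tuple R =>
  \sum_(i < d) (tnth c.1 i - tnth c.2 i) ^+ 2); last first.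
  by apply/funext => c; rewrite eucl_dist2.
apply: measurable_sum => i; apply: measurable_funX; apply: measurable_funB.
  exact: measurableT_comp (measurable_tnth i) measurable_fst.
exact: measurableT_comp (measurable_tnth i) measurable_snd.
Qed.

Lemma measurable_rayleigh_center p a : measurable_fun setT (rayleigh p a).
Proof.
exact: measurableT_comp (measurable_rayleigh p) (measurable_pair1 a).
Qed.

Definition barycenter p q u w : d.-tuple R :=
  [tuple (p * tnth u i + q * tnth w i) / (p + q) | i < d].

(** Completing the square. *)
Lemma rayleighM p q u w b : p + q != 0 ->
  rayleigh p u b * rayleigh q w b =
  rayleigh (p + q) (barycenter p q u w) b * rayleigh (p * q / (p + q)) u w.
Proof.
move=> pq; rewrite /rayleigh -!expRD !eucl_dist2; congr expR.
rewrite -!opprD !mulr_sumr -!big_split/=; congr (- _); apply: eq_bigr => i _.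
by rewrite tnth_mktuple; field.
Qed.

End rayleigh_theory.

(** The integrand is a multiple of the normal density of variance [1 / (2 p)]. *)
Lemma integral_gauss_fun (R : realType) (p u : R) : 0 < p ->
  (\int[lebesgue_measure]_r (expR (- (p * (u - r) ^+ 2)))%:E =
   (Num.sqrt (pi / p))%:E)%E.
Proof.
move=> p0; have p2 : 0 < (2 * p)^-1 by rewrite invr_gt0 mulr_gt0.
pose s := Num.sqrt (2 * p)^-1.
have s0 : s != 0 by rewrite gt_eqF// sqrtr_gt0.
have s2 : s ^+ 2 *+ 2 = p^-1.
  by rewrite sqr_sqrtr ?ltW// -mulr_natl invfM mulrA mulfV ?mul1r// pnatr_eq0.
have peakE : normal_peak s = (Num.sqrt (pi / p))^-1.
  by rewrite /normal_peak -mulrnAl s2 mulrC.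
have funE r : normal_fun u s r = expR (- (p * (u - r) ^+ 2)).
  rewrite /normal_fun s2 invrK; congr expR; ring.
have k0 : Num.sqrt (pi / p) != 0 by rewrite gt_eqF// sqrtr_gt0 divr_gt0// pi_gt0.
have := integral_normal_pdf u s; rewrite normal_pdfE// peakE.
rewrite (eq_integral (fun r : measurableTypeR R => ((Num.sqrt (pi / p))^-1)%:E *
    (expR (- (p * (u - r) ^+ 2)))%:E)%E); last first.
  by move=> r _; rewrite /= -EFinM funE.
rewrite ge0_integralZl_EFin//; last first.
  apply/measurable_EFinP.
  rewrite (_ : (fun _ => _) = normal_fun u s); last by apply/funext => r; rewrite funE.
  exact: measurable_normal_fun.
set I := (X in (_ * X)%E) => I1.
have : (((Num.sqrt (pi / p))%:E * ((Num.sqrt (pi / p))^-1)%:E * I = (Num.sqrt (pi / p))%:E))%E.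
  by rewrite -muleA I1 mule1.
by rewrite -EFinM mulfV// mul1e.
Qed.

Lemma integral_lebesgue_tupleS (R : realType) d (f : d.+1.-tuple R -> \bar R) :
  measurable_fun setT f -> (forall t, 0 <= f t)%E ->
  (\int[lebesgue_tuple R d.+1]_b f b =
   \int[lebesgue_measure]_r \int[lebesgue_tuple R d]_b f [tuple of r :: b])%E.
Proof.
move=> mf f0; rewrite (ge0_integral_pushforward measurable_cons_pair)//.
rewrite preimage_setT fubini_tonelli1//=.
exact: measurableT_comp mf measurable_cons_pair.
Qed.

Lemma integral_rayleigh (R : realType) d (p : R) (u : d.-tuple R) : 0 < p ->
  (\int[lebesgue_tuple R d]_b (rayleigh p u b)%:E = ((pi / p) `^ (d%:R / 2))%:E)%E.
Proof.
move=> p0; have pip : 0 < pi / p by rewrite divr_gt0// pi_gt0.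
elim: d u => [|d IH] u.
  rewrite /= integral_dirac//; last by apply/measurable_EFinP; exact: measurable_rayleigh_center.
  by rewrite diracT mul1e mul0r powRr0 /rayleigh eucl_dist2 big_ord0 mulr0 oppr0 expR0.
rewrite integral_lebesgue_tupleS; last 2 first.
- by apply/measurable_EFinP; exact: measurable_rayleigh_center.
- by move=> t; rewrite lee_fin rayleigh_ge0.
pose u' := [tuple of behead u].
transitivity (\int[lebesgue_measure]_r (((pi / p) `^ (d%:R / 2))%:E *
    (expR (- (p * (thead u - r) ^+ 2)))%:E))%E.
  apply: eq_integral => r _; rewrite -(IH u') muleC -ge0_integralZl_EFin//; last 2 first.
  - by move=> b _; rewrite lee_fin rayleigh_ge0.
  - by apply/measurable_EFinP; exact: measurable_rayleigh_center.
  apply: eq_integral => b _; rewrite -EFinM /rayleigh -expRD !eucl_dist2; congr (expR _)%:E.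
  rewrite big_ord_recl tnth0 -opprD -mulrDr; congr (- (p * (_ + _))).
  by apply: eq_bigr => i _; rewrite tnthS !(tnth_nth 0) /= nth_behead.
rewrite ge0_integralZl_EFin ?powR_ge0//; last first.
  apply/measurable_EFinP; apply: measurableT_comp; first exact: measurable_expR.
  apply: measurable_funN; apply: measurable_funM; first exact: measurable_cst.
  by apply: measurable_funX; apply: measurable_funB.
rewrite integral_gauss_fun// -EFinM -powR12_sqrt ?ltW// -powRD ?gt_eqF ?implybT//.
by congr ((_ `^ _)%:E); rewrite -natr1; field.
Qed.

(** * Integrals over the positions of the inner vertices *)

Section graph_integrals.
Context {R : realType} {d : nat}.
Implicit Types (u w : d.-tuple R) (p q c : R).
Local Notation mu := (lebesgue_tuple R d).
Local Notation K p := ((pi / p) `^ (d%:R / 2)).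

(** Merging the two Gaussian factors leaves one whose integral is known. *)
Lemma integral_rayleighM c p q u w : 0 <= c -> 0 < p -> 0 < q ->
  (\int[mu]_b (c * (rayleigh p u b * rayleigh q w b))%:E =
   (c * (K (p + q) * rayleigh (p * q / (p + q)) u w))%:E)%E.
Proof.
move=> c0 p0 q0; have pq : 0 < p + q by rewrite addr_gt0.
transitivity (\int[mu]_b ((c * rayleigh (p * q / (p + q)) u w)%:E *
    (rayleigh (p + q) (barycenter p q u w) b)%:E))%E.
  by apply: eq_integral => b _; rewrite rayleighM ?gt_eqF// -EFinM; congr EFin; ring.
rewrite ge0_integralZl_EFin//.
- by rewrite integral_rayleigh// -EFinM; congr EFin; ring.
- by move=> b _; rewrite lee_fin rayleigh_ge0.
- by apply/measurable_EFinP; exact: measurable_rayleigh_center.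
- by rewrite mulr_ge0 ?rayleigh_ge0.
Qed.

(** The integrand takes a sequence, of any length, so that for a numeral [k] the
    definition unfolds to [k] nested integrals. *)
Fixpoint iterated_integral k (f : seq (d.-tuple R) -> \bar R) : \bar R :=
  if k is k'.+1 then (\int[mu]_a iterated_integral k' (fun s => f (a :: s)))%E
  else f [::].

Lemma integral_power_iterated k (f : seq (d.-tuple R) -> \bar R) :
  measurable_fun setT (fun a : k.-tuple (d.-tuple R) => f a) ->
  (forall s, 0 <= f s)%E ->
  (\int[power_measure mu k]_a f a)%E = iterated_integral k f.
Proof.
elim: k f => [|k IH] f mf f0; first by rewrite integral_power_measure0.
transitivity (\int[mu]_b \int[power_measure mu k]_a f (b :: a))%E.
  exact: integral_power_measureS.
apply: eq_integral => b _; apply: (IH (fun s => f (b :: s))) => [|s]; last exact: f0.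
have := @measurable_cons _ _ (k.-tuple (d.-tuple R)) (d.-tuple R) (cst b) k id
  (@measurable_cst _ _ _ _ _ _) (@measurable_id _ _ _).
exact: measurableT_comp mf.
Qed.

Variable beta : R.
Hypothesis beta0 : 0 < beta.
Variables x y : d.-tuple R.
Local Notation H := (rayleigh beta).
Local Notation W k es := (\int[power_measure mu k]_a (weight x y H es a)%:E)%E.

Lemma integral_weight k es : W k es = iterated_integral k (fun s =>
  (\prod_(e <- es) H (nth x [:: x, y & s] e.1) (nth x [:: x, y & s] e.2))%:E).
Proof.
rewrite -(@integral_power_iterated k (fun s => (\prod_(e <- es)
  H (nth x [:: x, y & s] e.1) (nth x [:: x, y & s] e.2))%:E))//.
  apply/measurable_EFinP; apply: (@measurable_weight _ _ x y H).
  exact: measurable_rayleigh.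
by move=> s; rewrite lee_fin; apply: prodr_ge0 => e _; exact: rayleigh_ge0.
Qed.

(** Integrating out a vertex of degree two. *)
Lemma integral_cherry c u w : 0 <= c ->
  (\int[mu]_b (c * (H u b * H w b))%:E =
   (c * (K (2 * beta) * rayleigh (beta / 2) u w))%:E)%E.
Proof.
move=> c0; rewrite integral_rayleighM//.
rewrite (_ : beta + beta = 2 * beta); last ring.
by rewrite (_ : beta * beta / (2 * beta) = beta / 2)//; field; rewrite gt_eqF.
Qed.

Definition path_weight := K (2 * beta) * K (3 / 2 * beta) * rayleigh (beta / 3) x y.

Lemma integral_path c : 0 <= c ->
  (\int[mu]_a \int[mu]_b (c * (H x a * (H a b * H y b)))%:E =
   (c * path_weight)%:E)%E.
Proof.
move=> c0; transitivity
    (\int[mu]_a (c * K (2 * beta) * (H x a * rayleigh (beta / 2) y a))%:E)%E.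
  apply: eq_integral => a _; under eq_integral do rewrite mulrA.
  rewrite integral_cherry ?mulr_ge0 ?rayleigh_ge0//; congr EFin.
  by rewrite (rayleighC _ a y); ring.
rewrite integral_rayleighM ?mulr_ge0 ?powR_ge0 ?divr_gt0//; congr EFin.
rewrite (_ : beta + beta / 2 = 3 / 2 * beta); last by field.
rewrite (_ : beta * (beta / 2) / (3 / 2 * beta) = beta / 3); last by field; rewrite gt_eqF.
by rewrite /path_weight; ring.
Qed.

(** The union of two paths from [x] to [y] with two inner vertices each, according to
    the inner vertices that they share. Labels 0 and 1 stand for [x] and [y]. If one
    inner vertex is shared, it has label 2. *)
Definition path_graph : seq (nat * nat) := [:: (0, 2); (2, 3); (1, 3)]%N.

Definition disjoint_paths : seq (nat * nat) := path_graph ++ [:: (0, 4); (4, 5); (1, 5)]%N.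

Definition same_first : seq (nat * nat) := path_graph ++ [:: (2, 4); (1, 4)]%N.

Definition same_last : seq (nat * nat) :=
  [:: (0, 3); (2, 3); (1, 2); (0, 4); (2, 4)]%N.

Definition last_is_first : seq (nat * nat) :=
  path_graph ++ [:: (0, 4); (2, 4); (1, 2)]%N.

Definition reversed_inner : seq (nat * nat) := path_graph ++ [:: (0, 3); (1, 2)]%N.

Lemma weight_path_graph : W 2 path_graph = path_weight%:E.
Proof.
rewrite integral_weight /= -[path_weight]mul1r -integral_path//.
apply: eq_integral => a _; apply: eq_integral => b _.
by rewrite !big_cons big_nil /= mulr1 mul1r.
Qed.

(** The two paths have only the endpoints in common, so the integral factors. *)
Lemma weight_disjoint_paths : W 4 disjoint_paths = (path_weight ^+ 2)%:E.
Proof.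
have pw0 : 0 <= path_weight by rewrite !mulr_ge0 ?powR_ge0 ?rayleigh_ge0.
rewrite integral_weight /= expr2 -integral_path//.
apply: eq_integral => a _; apply: eq_integral => b _.
rewrite mulrC -integral_path; last by rewrite !mulr_ge0 ?rayleigh_ge0.
apply: eq_integral => c _; apply: eq_integral => e _.
by rewrite !big_cons big_nil /=; congr EFin; ring.
Qed.

(** The shared vertex is integrated last: each of the other two inner vertices has
    degree two and gives a Gaussian factor centred at an endpoint. *)
Lemma weight_same_first : W 3 same_first =
  (K (2 * beta) ^+ 3 * rayleigh (beta / 2) x y)%:E.
Proof.
rewrite integral_weight /=.
transitivity (\int[mu]_a (K (2 * beta) ^+ 2 * (H x a * H y a))%:E)%E; last first.
  by rewrite integral_cherry ?exprn_ge0 ?powR_ge0//; congr EFin; ring.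
apply: eq_integral => a _.
transitivity (\int[mu]_b (K (2 * beta) * rayleigh (beta / 2) a y * H x a *
    (H a b * H y b))%:E)%E.
  apply: eq_integral => b _.
  transitivity (\int[mu]_c (H x a * H a b * H y b * (H a c * H y c))%:E)%E.
    by apply: eq_integral => c _; rewrite !big_cons big_nil /=; congr EFin; ring.
  by rewrite integral_cherry ?mulr_ge0 ?rayleigh_ge0//; congr EFin; ring.
rewrite integral_cherry ?mulr_ge0 ?powR_ge0 ?rayleigh_ge0//; congr EFin.
by rewrite (rayleighC _ y a) (rayleigh_half beta a y); ring.
Qed.

Lemma weight_same_last : W 3 same_last =
  (K (2 * beta) ^+ 3 * rayleigh (beta / 2) x y)%:E.
Proof.
rewrite integral_weight /=.
transitivity (\int[mu]_a (K (2 * beta) ^+ 2 * (H x a * H y a))%:E)%E; last first.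
  by rewrite integral_cherry ?exprn_ge0 ?powR_ge0//; congr EFin; ring.
apply: eq_integral => a _.
transitivity (\int[mu]_b (K (2 * beta) * rayleigh (beta / 2) x a * H y a *
    (H x b * H a b))%:E)%E.
  apply: eq_integral => b _.
  transitivity (\int[mu]_c (H x b * H a b * H y a * (H x c * H a c))%:E)%E.
    by apply: eq_integral => c _; rewrite !big_cons big_nil /=; congr EFin; ring.
  by rewrite integral_cherry ?mulr_ge0 ?rayleigh_ge0//; congr EFin; ring.
rewrite integral_cherry ?mulr_ge0 ?powR_ge0 ?rayleigh_ge0//; congr EFin.
by rewrite (rayleigh_half beta x a); ring.
Qed.

Lemma weight_last_is_first : W 3 last_is_first =
  (K (2 * beta) ^+ 2 * K (3 * beta) * rayleigh (3 * beta / 4) x y)%:E.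
Proof.
rewrite integral_weight /=.
transitivity (\int[mu]_a (K (2 * beta) ^+ 2 *
    (rayleigh (3 / 2 * beta) x a * rayleigh (3 / 2 * beta) y a))%:E)%E; last first.
  rewrite integral_rayleighM ?exprn_ge0 ?powR_ge0 ?mulr_gt0//; congr EFin.
  rewrite (_ : 3 / 2 * beta + 3 / 2 * beta = 3 * beta); last by field.
  rewrite (_ : 3 / 2 * beta * (3 / 2 * beta) / (3 * beta) = 3 * beta / 4).
    by rewrite mulrA.
  by field; rewrite gt_eqF.
apply: eq_integral => a _.
transitivity (\int[mu]_b (K (2 * beta) * rayleigh (beta / 2) x a * H x a * H y a *
    (H a b * H y b))%:E)%E.
  apply: eq_integral => b _.
  transitivity (\int[mu]_c (H x a * H a b * H y b * H y a * (H x c * H a c))%:E)%E.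
    by apply: eq_integral => c _; rewrite !big_cons big_nil /=; congr EFin; ring.
  by rewrite integral_cherry ?mulr_ge0 ?rayleigh_ge0//; congr EFin; ring.
rewrite integral_cherry ?mulr_ge0 ?powR_ge0 ?rayleigh_ge0//; congr EFin.
rewrite (_ : 3 / 2 * beta = beta + beta / 2); last by field.
by rewrite -!rayleighD (rayleighC _ a y); ring.
Qed.

(** Both inner vertices are adjacent to both endpoints, which gives each of them a
    Gaussian weight centred at the midpoint of [x] and [y]. *)
Lemma weight_reversed_inner : W 2 reversed_inner =
  (K (3 * beta) * K (8 / 3 * beta) * rayleigh beta x y)%:E.
Proof.
rewrite integral_weight /=; pose m := barycenter beta beta x y.
have merge b : H x b * H y b = rayleigh (2 * beta) m b * rayleigh (beta / 2) x y.
  rewrite rayleighM; last by rewrite gt_eqF// addr_gt0.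
  rewrite (_ : beta + beta = 2 * beta); last ring.
  by rewrite (_ : beta * beta / (2 * beta) = beta / 2)//; field; rewrite gt_eqF.
transitivity (\int[mu]_a ((K (3 * beta) * rayleigh beta x y)%:E *
    (rayleigh (8 / 3 * beta) m a)%:E))%E; last first.
  rewrite ge0_integralZl_EFin//; last 3 first.
  - by move=> b _; rewrite lee_fin rayleigh_ge0.
  - by apply/measurable_EFinP; exact: measurable_rayleigh_center.
  - by rewrite mulr_ge0 ?powR_ge0 ?rayleigh_ge0.
  by rewrite integral_rayleigh ?mulr_gt0// -EFinM; congr EFin; ring.
apply: eq_integral => a _.
transitivity (\int[mu]_b (H x a * H y a * rayleigh (beta / 2) x y *
    (H a b * rayleigh (2 * beta) m b))%:E)%E.
  apply: eq_integral => b _; rewrite !big_cons big_nil /=; congr EFin.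
  transitivity (H x a * H y a * (H a b * (H x b * H y b))); first ring.
  by rewrite (merge b); ring.
rewrite integral_rayleighM ?mulr_ge0 ?rayleigh_ge0 ?mulr_gt0// -EFinM; congr EFin.
rewrite (merge a) (_ : beta + 2 * beta = 3 * beta); last ring.
rewrite (_ : beta * (2 * beta) / (3 * beta) = 2 / 3 * beta); last by field; rewrite gt_eqF.
rewrite (_ : 8 / 3 * beta = 2 * beta + 2 / 3 * beta); last by field.
by rewrite -rayleighD (rayleighC _ a m) (rayleigh_half beta x y); ring.
Qed.

End graph_integrals.

(** * The count as a sum of indicators *)

Section hop_count.
Context {R : realType} {d : nat} {disp : measure_display}.
Context {Omega : measurableType disp} (P : probability Omega R).
Variables (omega : Omega -> set (d.-tuple R)) (x y : d.-tuple R).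
Variable edge : Omega -> d.-tuple R -> d.-tuple R -> Prop.
Hypothesis edgeC : forall w a b, edge w a b -> edge w b a.
Variables (D : nat -> set Omega) (v : nat -> Omega -> d.-tuple R).
Hypothesis vD : vertex_enum omega x y D v.
Hypothesis medge : forall i j, (i < j)%N ->
  measurable [set w | [/\ D i w, D j w & edge w (v i w) (v j w)]].
Local Notation graph_copy := (graph_copy edge D v).

Lemma presentP k (t : k.-tuple nat) w :
  present D t w <-> (forall i, i \in (t : seq nat) -> D i w).
Proof.
split=> [Dt i /tnthP[j ->]|Dt i _]; first exact: Dt.
by apply: Dt; exact: mem_tnth.
Qed.

Lemma forall_in_cons (T : eqType) (Q : T -> Prop) (a : T) (s : seq T) :
  (forall b, b \in a :: s -> Q b) <-> Q a /\ (forall b, b \in s -> Q b).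
Proof.
split=> [h|[Qa h] b]; last by rewrite inE => /predU1P[->|/h].
by split=> [|b bs]; apply: h; rewrite inE ?eqxx// bs orbT.
Qed.

Lemma forall_in_nil (T : eqType) (Q : T -> Prop) :
  (forall b, b \in [::] -> Q b) <-> True.
Proof. by []. Qed.

(** Only the events of edges with increasing indices are measurable by hypothesis; an
    edge with decreasing indices is turned round. *)
Lemma measurable_graph_copy k es (t : k.-tuple nat) : graph_on k es -> admissible t ->
  measurable (graph_copy es t).
Proof.
move=> /andP[_ /allP ges] pt.
have inj a b : (a < k.+2)%N -> (b < k.+2)%N -> index_of t a = index_of t b -> a = b.
  by move=> ak bk /eqP; rewrite nth_uniq/= ?size_tuple// => /eqP.
have mes (es' : seq (nat * nat)) : {subset es' <= es} -> measurable (graph_copy es' t).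
  elim: es' => [_|e es' IH es'es].
    rewrite (_ : graph_copy _ _ = present D t); first exact: (measurable_present vD).
    by apply/seteqP; split => w; [case|move=> Dt; split].
  have /ges/andP[e12 e2] : e \in es by apply: es'es; rewrite inE eqxx.
  have e1 := ltn_trans e12 e2.
  pose i := index_of t e.1; pose j := index_of t e.2.
  have mij : measurable [set w | [/\ D i w, D j w & edge w (v i w) (v j w)]].
    case: (ltngtP i j) => ij; first exact: medge.
      rewrite (_ : [set _ | _] = [set w | [/\ D j w, D i w & edge w (v j w) (v i w)]]).
        exact: medge.
      by apply/seteqP; split => w [? ? /edgeC ?].
    by have := e12; rewrite (inj _ _ e1 e2 ij) ltnn.
  rewrite (_ : graph_copy _ _ =
      graph_copy es' t `&` [set w | [/\ D i w, D j w & edge w (v i w) (v j w)]]).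
    by apply: measurableI => //; apply: IH => b bs; apply: es'es; rewrite inE bs orbT.
  apply/seteqP; split => w.
    move=> [Dt /forall_in_cons[/= wij wes']]; split; first by split.
    by split => //; [case: (index_ofE vD Dt e1)|case: (index_ofE vD Dt e2)].
  by move=> [[Dt wes'] [Di Dj wij]]; split => //; apply/forall_in_cons.
exact: mes.
Qed.

Definition hop_event (t : 2.-tuple nat) : set Omega :=
  if admissible t then graph_copy path_graph t else set0.

Lemma measurable_hop t : measurable (hop_event t).
Proof.
by rewrite /hop_event; case: ifP => // pt; exact: measurable_graph_copy.
Qed.

Lemma tuple2P (t : 2.-tuple nat) : exists a b, t = [tuple a; b].
Proof. by case: t => -[|a [|b [|? ?]]]//= st; exists a, b; exact/val_inj. Qed.

Lemma tuple3P (t : 3.-tuple nat) : exists a b c, t = [tuple a; b; c].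
Proof. by case: t => -[|a [|b [|c [|? ?]]]]//= st; exists a, b, c; exact/val_inj. Qed.

Lemma tuple4P (t : 4.-tuple nat) : exists a b c e, t = [tuple a; b; c; e].
Proof.
by case: t => -[|a [|b [|c [|e [|? ?]]]]]//= st; exists a, b, c, e; exact/val_inj.
Qed.

Lemma admissible2 a b : admissible [tuple a; b] = [&& (2 <= a)%N, (2 <= b)%N & a != b].
Proof. by rewrite /admissible /= !inE; apply/idP/idP; lia. Qed.

Lemma graph_copyP k es (t : k.-tuple nat) w : graph_copy es t w <->
  (forall i, i \in (t : seq nat) -> D i w) /\
  (forall e, e \in [seq (index_of t e.1, index_of t e.2) | e <- es] ->
    edge w (v e.1 w) (v e.2 w)).
Proof. by split=> -[/presentP ? ?]; split => //; apply/presentP. Qed.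

Lemma hop_eventP a b w : hop_event [tuple a; b] w <->
  admissible [tuple a; b] /\ [/\ D a w, D b w, edge w x (v a w),
    edge w (v a w) (v b w) & edge w y (v b w)].
Proof.
have [v0 v1] : v 0%N w = x /\ v 1%N w = y by case: vD => _ _ [_ ->] [_ ->].
rewrite /hop_event; case: ifPn => [_|pab]; last by split => // -[].
rewrite graph_copyP /= !forall_in_cons /= /index_of /= v0 v1.
split; first by move=> [[? [? _]] [? [? [? _]]]].
by move=> [_ [? ? ? ? ?]].
Qed.

Lemma hops3_image w : hops3 omega x y edge w =
  (fun t : 2.-tuple nat => (v (tnth t ord0) w, v (tnth t ord_max) w)) @` [set t | hop_event t w].
Proof.
apply/seteqP; split => [[z1 z2]|_ [t /= + <-]]; last first.
  have [a [b ->]] := tuple2P t; rewrite hop_eventP admissible2.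
  move=> [/and3P[a2 b2 ab] [Da Db xa ab_ yb]]; split; split => //=.
  - by rewrite (ve_points vD); exists a.
  - by rewrite (ve_points vD); exists b.
  - case: (vD) => _ _ _ _ _ vI vab; have := vI w a b a2 b2 Da Db vab.
    by move/eqP; rewrite (negbTE ab).
  - exact: edgeC.
move=> [[/=]]; rewrite (ve_points vD) => -[a [a2 Da <-]] [b [b2 Db <-]] z12 [xa ab yb].
exists [tuple a; b] => //=; apply/hop_eventP; rewrite admissible2 a2 b2/=; split.
  by apply/negP => /eqP ab'; apply: z12; rewrite ab'.
by split => //; exact: edgeC.
Qed.

Local Open Scope ereal_scope.

Lemma counting_hops3 w : counting (hops3 omega x y edge w) =
  \esum_(t in [set: 2.-tuple nat]) (\1_(hop_event t) w)%:E :> \bar R.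
Proof.
rewrite countingE hops3_image esum_image; last first.
  move=> t u /set_mem + /set_mem.
  have [a [b ->]] := tuple2P t; have [a' [b' ->]] := tuple2P u.
  move=> /= /hop_eventP[]; rewrite admissible2 => /and3P[a2 b2 _] [Da Db _ _ _].
  move=> /hop_eventP[]; rewrite admissible2 => /and3P[a2' b2' _] [Da' Db' _ _ _] [vaa' vbb'].
  case: vD => _ _ _ _ _ vI.
  by rewrite (vI w a a') // (vI w b b').
rewrite esum_mkcond; apply: eq_esum => t _; rewrite indicE.
by rewrite [in RHS](_ : (w \in hop_event t) = (t \in [set t | hop_event t w]))//; case: ifPn.
Qed.

End hop_count.

(** * Variance of the count *)

Section variance_of_count.
Context {disp : measure_display} {T : measurableType disp} {R : realType}.
Variable P : probability T R.
Local Open Scope ereal_scope.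

Lemma Lfun2_sqr (f : T -> R) : measurable_fun setT f ->
  \int[P]_t (f t ^+ 2)%:E < +oo -> f \in Lfun P 2%:E.
Proof.
move=> mf f2; rewrite inE; apply/andP; split; rewrite inE//=.
rewrite /finite_norm unlock /Lnorm; apply: poweR_lty; apply: le_lt_trans f2.
rewrite le_eqVlt; apply/orP; left; apply/eqP; apply: eq_integral => t _.
by rewrite /= powR_mulrn// real_normK// num_real.
Qed.

(** A count with finite mean is almost surely finite, so sending infinite values to 0
    changes no moment. *)
Lemma variance_fine (N : T -> \bar R) (m s : R) :
  measurable_fun setT N -> (forall t, 0 <= N t) ->
  \int[P]_t N t = m%:E -> \int[P]_t (N t * N t) = s%:E ->
  'V_P[fine \o N] = (s - m ^+ 2)%:E.
Proof.
move=> mN N0 Nm Ns.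
have Nfin : {ae P, forall t, setT t -> N t \is a fin_num}.
  apply: integrable_ae => //; apply/integrableP; split => //.
  by under eq_integral do rewrite gee0_abs//; rewrite Nm ltry.
have mf : measurable_fun setT (fine \o N) by exact: measurableT_comp.
have E1 : \int[P]_t ((fine \o N) t)%:E = m%:E.
  rewrite -Nm; apply: ge0_ae_eq_integral => //.
  - exact/measurable_EFinP.
  - by move=> t _; rewrite lee_fin fine_ge0.
  - by apply: filterS Nfin => t h _; rewrite /= fineK//; exact: h.
have E2 : \int[P]_t ((fine \o N) t ^+ 2)%:E = s%:E.
  rewrite -Ns; apply: ge0_ae_eq_integral => //.
  - by apply/measurable_EFinP; exact: measurable_funX.
  - exact: emeasurable_funM.
  - by move=> t _; rewrite lee_fin sqr_ge0.
  - by move=> t _; exact: mule_ge0.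
  - by apply: filterS Nfin => t h _; rewrite /= expr2 EFinM fineK//; exact: h.
rewrite varianceE; last by apply: Lfun2_sqr => //; rewrite E2 ltry.
rewrite unlock E1 (_ : \int[P]_w _ = s%:E)//.
Qed.

End variance_of_count.

Section hop_moments.
Context {R : realType} {d : nat} {disp : measure_display}.
Context {Omega : measurableType disp} (P : probability Omega R).
Variables (omega : Omega -> set (d.-tuple R)) (x y : d.-tuple R).
Variable edge : Omega -> d.-tuple R -> d.-tuple R -> Prop.
Hypothesis edgeC : forall w a b, edge w a b -> edge w b a.
Variables (D : nat -> set Omega) (v : nat -> Omega -> d.-tuple R).
Hypothesis vD : vertex_enum omega x y D v.
Hypothesis medge : forall i j, (i < j)%N ->
  measurable [set w | [/\ D i w, D j w & edge w (v i w) (v j w)]].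
Local Notation graph_copy := (graph_copy edge D v).
Local Notation hop := (hop_event edge D v).
Local Open Scope ereal_scope.

Let N w : \bar R := counting (hops3 omega x y edge w).

Lemma measurable_hop_count : measurable_fun setT N.
Proof.
rewrite (_ : N = fun w => \esum_(t in [set: 2.-tuple nat]) (\1_(hop t) w)%:E); last first.
  by apply/funext => w; rewrite /N (counting_hops3 edgeC vD).
apply: measurable_esum => [t|t w]; last by rewrite lee_fin.
by apply/measurable_EFinP; apply: measurable_indic; exact: (measurable_hop edgeC vD).
Qed.

Lemma first_moment :
  \int[P]_w N w = \esum_(t in [set t : 2.-tuple nat | admissible t]) P (graph_copy path_graph t).
Proof.
transitivity (\int[P]_w (\esum_(t in [set: 2.-tuple nat]) (\1_(hop t) w)%:E)).
  by apply: eq_integral => w _; rewrite /N (counting_hops3 edgeC vD).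
have mhop := measurable_hop edgeC vD medge.
rewrite integral_esum => [|t|t w]; last by rewrite lee_fin.
  rewrite [RHS]esum_mkcond; apply: eq_esum => t _.
  rewrite (integral_indic _ measurableT (mhop t)) setIT.
  have -> : (t \in [set t | admissible t]) = admissible t by apply/idP/idP; rewrite inE.
  by rewrite /hop_event; case: ifP => // _; rewrite measure0.
by apply/measurable_EFinP; exact: measurable_indic.
Qed.

Definition pair_prob (p : 2.-tuple nat * 2.-tuple nat) : \bar R :=
  P (hop p.1 `&` hop p.2).

Lemma second_moment_pairs :
  \int[P]_w (N w * N w) = \esum_(p in [set: 2.-tuple nat * 2.-tuple nat]) pair_prob p.
Proof.
have mhop := measurable_hop edgeC vD medge.
have i0 (t : 2.-tuple nat) w : 0 <= (\1_(hop t) w)%:E :> \bar R by rewrite lee_fin.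
have mi t : measurable_fun setT (fun w => (\1_(hop t) w)%:E : \bar R).
  by apply/measurable_EFinP; exact: measurable_indic.
transitivity (\int[P]_w (\esum_(t in [set: 2.-tuple nat])
    \esum_(u in [set: 2.-tuple nat]) ((\1_(hop t) w)%:E * (\1_(hop u) w)%:E))).
  apply: eq_integral => w _; rewrite /N (counting_hops3 edgeC vD) -esumZr//.
    by apply: eq_esum => t _; rewrite esumZl.
  exact: esum_ge0.
rewrite integral_esum; last 2 first.
- by move=> t; apply: measurable_esum => [u|u w]; [exact: emeasurable_funM|exact: mule_ge0].
- by move=> t w; apply: esum_ge0 => u _; exact: mule_ge0.
transitivity (\esum_(t in [set: 2.-tuple nat]) \esum_(u in [set: 2.-tuple nat])
    pair_prob (t, u)).
  apply: eq_esum => t _; rewrite integral_esum; last 2 first.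
  - by move=> u; exact: emeasurable_funM.
  - by move=> u w; exact: mule_ge0.
  apply: eq_esum => u _; rewrite /pair_prob/=.
  rewrite -[hop t `&` hop u]setIT -(integral_indic _ measurableT); last exact: measurableI.
  by apply: eq_integral => w _; rewrite indicI.
rewrite esum_esum; last by move=> *; rewrite /pair_prob.
rewrite (_ : setT `*`` _ = setT); last by apply/seteqP; split.
by congr esum; apply/funext => -[].
Qed.

Lemma admissible3 a b c : admissible [tuple a; b; c] =
  [&& admissible [tuple a; b], admissible [tuple a; c] & b != c].
Proof. by rewrite /admissible /= !inE; apply/idP/idP; lia. Qed.

Lemma admissible4 a b c e : admissible [tuple a; b; c; e] =
  [&& admissible [tuple a; b], admissible [tuple c; e] &
      [&& a != c, a != e & (b != c) && (b != e)]].
Proof. by rewrite /admissible /= !inE; apply/idP/idP; lia. Qed.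

Definition admissibleE := (admissible4, admissible3, admissible2).

(** The sum is split according to which entries of the first pair of indices equal
    which entries of the second. Each pair having distinct entries, seven of the
    sixteen cases are possible. *)
Lemma pair_prob_split :
  \esum_(p in [set: 2.-tuple nat * 2.-tuple nat]) pair_prob p =
  (\esum_(t in [set t : 2.-tuple nat | admissible t]) P (graph_copy path_graph t) +
   \esum_(t in [set t : 3.-tuple nat | admissible t]) P (graph_copy same_first t)) +
  (\esum_(t in [set t : 3.-tuple nat | admissible t]) P (graph_copy same_last t) +
   ((\esum_(t in [set t : 2.-tuple nat | admissible t]) P (graph_copy reversed_inner t) +
     \esum_(t in [set t : 3.-tuple nat | admissible t]) P (graph_copy last_is_first t)) +
    (\esum_(t in [set t : 3.-tuple nat | admissible t]) P (graph_copy last_is_first t) +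
     \esum_(t in [set t : 4.-tuple nat | admissible t]) P (graph_copy disjoint_paths t)))).
Proof.
pose i (p : 2.-tuple nat * 2.-tuple nat) := nth 0%N p.1 0.
pose j (p : 2.-tuple nat * 2.-tuple nat) := nth 0%N p.1 1.
pose k (p : 2.-tuple nat * 2.-tuple nat) := nth 0%N p.2 0.
pose l (p : 2.-tuple nat * 2.-tuple nat) := nth 0%N p.2 1.
have p0 p : 0 <= pair_prob p by rewrite /pair_prob.
have v01 w : v 0%N w = x /\ v 1%N w = y by case: vD => _ _ [_ ->] [_ ->].
pose Q := [set p : 2.-tuple nat * 2.-tuple nat | admissible p.1 && admissible p.2].
have reindex n (es : seq (nat * nat)) (f : n.-tuple nat -> 2.-tuple nat * 2.-tuple nat)
    (S : set (2.-tuple nat * 2.-tuple nat)) :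
    set_bij [set t | admissible t] S f ->
    (forall t w, admissible t -> graph_copy es t w <-> hop (f t).1 w /\ hop (f t).2 w) ->
    \esum_(p in S) pair_prob p =
    \esum_(t in [set t : n.-tuple nat | admissible t]) P (graph_copy es t).
  move=> fS fE; rewrite (reindex_esum [set t | admissible t] S f)//; apply: eq_esum => t pt.
  by congr (P _); apply/seteqP; split => w /(fE t w pt).
rewrite (esumID Q)// setTI [X in _ + X]esum1 ?adde0; last first.
  move=> [t u] [_ /negP] /=; rewrite negb_and /pair_prob /hop_event /= => /orP[] /negbTE ->.
    by rewrite set0I measure0.
  by rewrite setI0 measure0.
pose A := [set p | i p = k p]; pose B := [set p | j p = l p].
pose C := [set p | i p = l p]; pose E := [set p | j p = k p].
have esumID0 S S' : \esum_(p in S) pair_prob p =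
  \esum_(p in S `&` S') pair_prob p + \esum_(p in S `&` ~` S') pair_prob p.
  exact: esumID.
rewrite (esumID0 Q A) (esumID0 (Q `&` A) B) (esumID0 (Q `&` ~` A) B).
rewrite (esumID0 (Q `&` ~` A `&` ~` B) C) (esumID0 (Q `&` ~` A `&` ~` B `&` C) E).
rewrite (esumID0 (Q `&` ~` A `&` ~` B `&` ~` C) E).
have tupE (a b a' b' c e c' e' : nat) :
    ([tuple a; b], [tuple c; e]) = ([tuple a'; b'], [tuple c'; e']) ->
    [/\ a = a', b = b', c = c' & e = e'].
  by move/(congr1 (fun p => (tval p.1, tval p.2))) => /= [].
have tupI (a b a' b' c e c' e' : nat) : a = a' -> b = b' -> c = c' -> e = e' ->
    ([tuple a; b], [tuple c; e]) = ([tuple a'; b'], [tuple c'; e']).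
  by move=> -> -> -> ->.
have hopE w a b : [&& 2 <= a, 2 <= b & a != b]%N -> hop [tuple a; b] w <->
    D a w /\ D b w /\ edge w x (v a w) /\ edge w (v a w) (v b w) /\ edge w y (v b w).
  move=> pab; rewrite (hop_eventP edge vD) admissible2.
  by split=> [[_ []]|[? [? [? []]]]].
have sym w a b : edge w (v a w) (v b w) <-> edge w (v b w) (v a w).
  by split; exact: edgeC.
congr (_ + _ + (_ + (_ + _ + (_ + _)))).
- apply: (reindex _ _ (fun t => ([tuple nth 0%N t 0; nth 0%N t 1],
    [tuple nth 0%N t 0; nth 0%N t 1]))).
    split.
    + move=> t /=; have [a [b ->]] := tuple2P t.
      rewrite /Q /A /B /C /E /i /j /k /l /= !admissibleE; lia.
    + move=> t u _ _; have [a [b ->]] := tuple2P t; have [a' [b' ->]] := tuple2P u.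
      by move=> /= /tupE[] *; subst.
    + move=> [t u]; have [a [b ->]] := tuple2P t; have [c [e ->]] := tuple2P u.
      rewrite /Q /A /B /C /E /i /j /k /l /= !admissible2 => h.
      exists [tuple a; b]; first by rewrite /= !admissibleE; lia.
      by apply: tupI => /=; lia.
  move=> t w; have [a [b ->]] := tuple2P t; rewrite !admissibleE => pt /=.
  rewrite !hopE; try by lia.
  rewrite graph_copyP /= !forall_in_cons !forall_in_nil /= /index_of /=.
  rewrite (v01 w).1 (v01 w).2; tauto.
- apply: (reindex _ _ (fun t => ([tuple nth 0%N t 0; nth 0%N t 1],
    [tuple nth 0%N t 0; nth 0%N t 2]))).
    split.
    + move=> t /=; have [a [b [c ->]]] := tuple3P t.
      rewrite /Q /A /B /C /E /i /j /k /l /= !admissibleE; lia.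
    + move=> t u _ _; have [a [b [c ->]]] := tuple3P t; have [a' [b' [c' ->]]] := tuple3P u.
      by move=> /= /tupE[] *; subst.
    + move=> [t u]; have [a [b ->]] := tuple2P t; have [c [e ->]] := tuple2P u.
      rewrite /Q /A /B /C /E /i /j /k /l /= !admissible2 => h.
      exists [tuple a; b; e]; first by rewrite /= !admissibleE; lia.
      by apply: tupI => /=; lia.
  move=> t w; have [a [b [c ->]]] := tuple3P t; rewrite !admissibleE => pt /=.
  rewrite !hopE; try by lia.
  rewrite graph_copyP /= !forall_in_cons !forall_in_nil /= /index_of /=.
  rewrite (v01 w).1 (v01 w).2; tauto.
- apply: (reindex _ _ (fun t => ([tuple nth 0%N t 1; nth 0%N t 0],
    [tuple nth 0%N t 2; nth 0%N t 0]))).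
    split.
    + move=> t /=; have [a [b [c ->]]] := tuple3P t.
      rewrite /Q /A /B /C /E /i /j /k /l /= !admissibleE; lia.
    + move=> t u _ _; have [a [b [c ->]]] := tuple3P t; have [a' [b' [c' ->]]] := tuple3P u.
      by move=> /= /tupE[] *; subst.
    + move=> [t u]; have [a [b ->]] := tuple2P t; have [c [e ->]] := tuple2P u.
      rewrite /Q /A /B /C /E /i /j /k /l /= !admissible2 => h.
      exists [tuple b; a; c]; first by rewrite /= !admissibleE; lia.
      by apply: tupI => /=; lia.
  move=> t w; have [a [b [c ->]]] := tuple3P t; rewrite !admissibleE => pt /=.
  rewrite !hopE; try by lia.
  rewrite graph_copyP /= !forall_in_cons !forall_in_nil /= /index_of /=.
  rewrite (v01 w).1 (v01 w).2 (sym w b a) (sym w c a); tauto.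
- apply: (reindex _ _ (fun t => ([tuple nth 0%N t 0; nth 0%N t 1],
    [tuple nth 0%N t 1; nth 0%N t 0]))).
    split.
    + move=> t /=; have [a [b ->]] := tuple2P t.
      rewrite /Q /A /B /C /E /i /j /k /l /= !admissibleE; lia.
    + move=> t u _ _; have [a [b ->]] := tuple2P t; have [a' [b' ->]] := tuple2P u.
      by move=> /= /tupE[] *; subst.
    + move=> [t u]; have [a [b ->]] := tuple2P t; have [c [e ->]] := tuple2P u.
      rewrite /Q /A /B /C /E /i /j /k /l /= !admissible2 => h.
      exists [tuple a; b]; first by rewrite /= !admissibleE; lia.
      by apply: tupI => /=; lia.
  move=> t w; have [a [b ->]] := tuple2P t; rewrite !admissibleE => pt /=.
  rewrite !hopE; try by lia.
  rewrite graph_copyP /= !forall_in_cons !forall_in_nil /= /index_of /=.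
  rewrite (v01 w).1 (v01 w).2 (sym w b a); tauto.
- apply: (reindex _ _ (fun t => ([tuple nth 0%N t 0; nth 0%N t 1],
    [tuple nth 0%N t 2; nth 0%N t 0]))).
    split.
    + move=> t /=; have [a [b [c ->]]] := tuple3P t.
      rewrite /Q /A /B /C /E /i /j /k /l /= !admissibleE; lia.
    + move=> t u _ _; have [a [b [c ->]]] := tuple3P t; have [a' [b' [c' ->]]] := tuple3P u.
      by move=> /= /tupE[] *; subst.
    + move=> [t u]; have [a [b ->]] := tuple2P t; have [c [e ->]] := tuple2P u.
      rewrite /Q /A /B /C /E /i /j /k /l /= !admissible2 => h.
      exists [tuple a; b; c]; first by rewrite /= !admissibleE; lia.
      by apply: tupI => /=; lia.
  move=> t w; have [a [b [c ->]]] := tuple3P t; rewrite !admissibleE => pt /=.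
  rewrite !hopE; try by lia.
  rewrite graph_copyP /= !forall_in_cons !forall_in_nil /= /index_of /=.
  rewrite (v01 w).1 (v01 w).2 (sym w c a); tauto.
- apply: (reindex _ _ (fun t => ([tuple nth 0%N t 2; nth 0%N t 0],
    [tuple nth 0%N t 0; nth 0%N t 1]))).
    split.
    + move=> t /=; have [a [b [c ->]]] := tuple3P t.
      rewrite /Q /A /B /C /E /i /j /k /l /= !admissibleE; lia.
    + move=> t u _ _; have [a [b [c ->]]] := tuple3P t; have [a' [b' [c' ->]]] := tuple3P u.
      by move=> /= /tupE[] *; subst.
    + move=> [t u]; have [a [b ->]] := tuple2P t; have [c [e ->]] := tuple2P u.
      rewrite /Q /A /B /C /E /i /j /k /l /= !admissible2 => h.
      exists [tuple b; e; a]; first by rewrite /= !admissibleE; lia.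
      by apply: tupI => /=; lia.
  move=> t w; have [a [b [c ->]]] := tuple3P t; rewrite !admissibleE => pt /=.
  rewrite !hopE; try by lia.
  rewrite graph_copyP /= !forall_in_cons !forall_in_nil /= /index_of /=.
  rewrite (v01 w).1 (v01 w).2 (sym w c a); tauto.
- apply: (reindex _ _ (fun t => ([tuple nth 0%N t 0; nth 0%N t 1],
    [tuple nth 0%N t 2; nth 0%N t 3]))).
    split.
    + move=> t /=; have [a [b [c [e ->]]]] := tuple4P t.
      rewrite /Q /A /B /C /E /i /j /k /l /= !admissibleE; lia.
    + move=> t u _ _; have [a [b [c [e ->]]]] := tuple4P t.
      have [a' [b' [c' [e' ->]]]] := tuple4P u.
      by move=> /= /tupE[] *; subst.
    + move=> [t u]; have [a [b ->]] := tuple2P t; have [c [e ->]] := tuple2P u.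
      rewrite /Q /A /B /C /E /i /j /k /l /= !admissible2 => h.
      exists [tuple a; b; c; e]; first by rewrite /= !admissibleE; lia.
      by apply: tupI => /=; lia.
  move=> t w; have [a [b [c [e ->]]]] := tuple4P t; rewrite !admissibleE => pt /=.
  rewrite !hopE; try by lia.
  rewrite graph_copyP /= !forall_in_cons !forall_in_nil /= /index_of /=.
  rewrite (v01 w).1 (v01 w).2; tauto.
Qed.

End hop_moments.

Theorem corollary5p3 (R : realType) (d : nat) (lambda beta : R)
    (lambda_gt0 : 0 < lambda) (beta_gt0 : 0 < beta)
    (disp : measure_display) (Omega : measurableType disp)
    (P : probability Omega R)
    (omega : Omega -> set (d.-tuple R))
    (edge : Omega -> d.-tuple R -> d.-tuple R -> Prop)
    (x y : d.-tuple R) (xy : x <> y)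
    (omega_poisson :
      poisson_process P (fun B => lambda%:E * lebesgue_tuple R d B)%E omega)
    (edge_rcm : random_connection_model P (rayleigh beta) omega x y edge) :
  'V_P[hop3_count omega x y edge] =
    (2 * lambda ^+ 3 * ((pi ^+ 3 / (8 * beta ^+ 3)) `^ (d%:R / 2))
        * expR (- (beta * eucl_dist x y ^+ 2 / 2))
     + lambda ^+ 2 * ((pi ^+ 2 / (3 * beta ^+ 2)) `^ (d%:R / 2))
        * expR (- (beta * eucl_dist x y ^+ 2 / 3))
     + 2 * lambda ^+ 3 * ((pi ^+ 3 / (12 * beta ^+ 3)) `^ (d%:R / 2))
        * expR (- (3 * beta * eucl_dist x y ^+ 2 / 4))
     + lambda ^+ 2 * ((pi ^+ 2 / (8 * beta ^+ 2)) `^ (d%:R / 2))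
        * expR (- (beta * eucl_dist x y ^+ 2)))%:E.
Proof.
have d0 : (0 < d)%N.
  by rewrite lt0n; apply/eqP => d0; subst d; apply: xy; rewrite (tuple0 x) (tuple0 y).
have l0 := ltW lambda_gt0.
case: edge_rcm => _ edgeC [D [v [vD medge edge_cond]]].
have copies k es : graph_on k es ->
    (\esum_(t in [set t : k.-tuple nat | admissible t]) P (graph_copy edge D v es t) =
    (lambda ^+ k)%:E * \int[power_measure (lebesgue_tuple R d) k]_a
      (weight x y (rayleigh beta) es a)%:E)%E.
  move=> ges; apply: (expected_copies edgeC (rayleighC beta) (rayleigh_ge0 beta)
    (measurable_rayleigh beta) vD edge_cond l0 omega_poisson d0 ges).
rewrite -[hop3_count _ _ _ _]/(fine \o (fun w => counting (hops3 omega x y edge w))).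
pose K p : R := (pi / p) `^ (d%:R / 2); pose J := path_weight beta x y.
have ray p q : p * eucl_dist x y ^+ 2 = q -> rayleigh p x y = expR (- q) by move=> <-.
have p0 : 0 <= pi :> R by exact: pi_ge0.
have KM p q : 0 < p -> 0 < q -> K p * K q = (pi ^+ 2 / (p * q)) `^ (d%:R / 2).
  move=> p0' q0; rewrite /K -powRM ?divr_ge0// ?ltW//; congr (_ `^ _).
  by field; rewrite !gt_eqF.
have KM3 p q s : 0 < p -> 0 < q -> 0 < s ->
    K p * K q * K s = (pi ^+ 3 / (p * q * s)) `^ (d%:R / 2).
  move=> p0' q0 s0; rewrite KM// /K -powRM ?divr_ge0 ?exprn_ge0 ?mulr_ge0// ?ltW//.
  congr (_ `^ _).
  by field; rewrite !gt_eqF.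
rewrite (@variance_fine _ _ _ P _ (lambda ^+ 2 * J)
  (lambda ^+ 2 * J + lambda ^+ 3 * (K (2 * beta) ^+ 3 * rayleigh (beta / 2) x y) +
   (lambda ^+ 3 * (K (2 * beta) ^+ 3 * rayleigh (beta / 2) x y) +
    (lambda ^+ 2 * (K (3 * beta) * K (8 / 3 * beta) * rayleigh beta x y) +
     lambda ^+ 3 * (K (2 * beta) ^+ 2 * K (3 * beta) * rayleigh (3 * beta / 4) x y) +
     (lambda ^+ 3 * (K (2 * beta) ^+ 2 * K (3 * beta) * rayleigh (3 * beta / 4) x y) +
      lambda ^+ 4 * J ^+ 2))))); last 4 first.
- exact: (measurable_hop_count edgeC vD).
- by move=> w; rewrite countingE; exact: esum_ge0.
- by rewrite (first_moment P edgeC vD)// copies// weight_path_graph.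
- rewrite (second_moment_pairs P edgeC vD)// (pair_prob_split P edgeC vD)// !copies//.
  rewrite weight_path_graph// weight_same_first// weight_same_last// weight_reversed_inner//.
  by rewrite weight_last_is_first// weight_disjoint_paths.
congr EFin.
rewrite /J /path_weight -/(K _) -/(K _).
rewrite (ray (beta / 2) (beta * eucl_dist x y ^+ 2 / 2)); last by field.
rewrite (ray (beta / 3) (beta * eucl_dist x y ^+ 2 / 3)); last by field.
rewrite (ray (3 * beta / 4) (3 * beta * eucl_dist x y ^+ 2 / 4)); last by field.
rewrite (ray beta (beta * eucl_dist x y ^+ 2))//.
have -> : (pi ^+ 3 / (8 * beta ^+ 3)) `^ (d%:R / 2) = K (2 * beta) ^+ 3.
  rewrite [RHS]exprSr [X in _ = X * _]expr2 KM3 ?mulr_gt0//; congr (_ `^ _).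
  by field; rewrite ?gt_eqF.
have -> : (pi ^+ 2 / (3 * beta ^+ 2)) `^ (d%:R / 2) = K (2 * beta) * K (3 / 2 * beta).
  by rewrite KM ?mulr_gt0//; congr (_ `^ _); field; rewrite ?gt_eqF.
have -> : (pi ^+ 3 / (12 * beta ^+ 3)) `^ (d%:R / 2) = K (2 * beta) ^+ 2 * K (3 * beta).
  by rewrite [X in _ = X * _]expr2 KM3 ?mulr_gt0//; congr (_ `^ _); field; rewrite ?gt_eqF.
have -> : (pi ^+ 2 / (8 * beta ^+ 2)) `^ (d%:R / 2) = K (3 * beta) * K (8 / 3 * beta).
  by rewrite KM ?mulr_gt0//; congr (_ `^ _); field; rewrite ?gt_eqF.
ring.
Qed.
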